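(* For each $n$, the graded ring $\mathscr G_n(q)$ satisfies $$K_{\boldsymbol\lambda}(n)K_{\boldsymbol\mu}(n)=\sum_{\|\boldsymbol\nu\|=\|\boldsymbol\lambda\|+\|\boldsymbol\mu\|}a^{\boldsymbol\nu}_{\boldsymbol\lambda\boldsymbol\mu}K_{\boldsymbol\nu}(n)$$ for all $\boldsymbol\lambda,\boldsymbol\mu\in\mathcal{P}(\Phi)$. Moreover, for each $n$ the $\mathbb Z$-linear map $\mathscr G(q)\to\mathscr G_n(q)$ sending $K_{\boldsymbol\lambda}$ to $K_{\boldsymbol\lambda}(n)$ for all $\boldsymbol\lambda\in\mathcal{P}(\Phi)$ is a surjective algebra homomorphism.
   Context: Let $q$ be a prime power, $G_n=GL_n(\mathbb F_q)$, with $G_m\subset G_n$ via $g\mapsto\mathrm{diag}(g,I_{n-m})$. Let $\Phi$ be the set of monic irreducible polynomials in $\mathbb F_q[t]$ other than $t$, $d(f)$ the degree of $f$, and $\mathcal{P}(\Phi)$ the set of finitely supported maps $\boldsymbol\lambda$ from $\Phi$ to partitions; $\|\boldsymbol\lambda\|=\sum_f d(f)|\boldsymbol\lambda(f)|$, $\boldsymbol\lambda^e=\boldsymbol\lambda(t-1)$, $\ell$ = number of nonzero parts. The type of $g\in G_n$ is the $\boldsymbol\lambda$ with $\mathbb F_q^n\cong\bigoplus_{f,i}\mathbb F_q[t]/(f^{\boldsymbol\lambda_i(f)})$ as $\mathbb F_q[t]$-modules ($t$ acting by $g$); its modified type $\mathring{\boldsymbol\lambda}$ agrees with $\boldsymbol\lambda$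 off $t-1$ and has $\mathring{\boldsymbol\lambda}(t-1)=(\boldsymbol\lambda^e_1-1,\dots,\boldsymbol\lambda^e_r-1)$ (zero parts discarded), $r=\ell(\boldsymbol\lambda^e)$. $K_{\boldsymbol\mu}(n)\in\mathbb Z[G_n]$ is the sum of the elements of $G_n$ of modified type $\boldsymbol\mu$ (zero if none, which happens iff $\|\boldsymbol\mu\|+\ell(\boldsymbol\mu^e)>n$); the nonzero ones form a $\mathbb Z$-basis of the center $\mathscr Z_n(q)$ of $\mathbb Z[G_n]$, with structure constants $K_{\boldsymbol\lambda}(n)K_{\boldsymbol\mu}(n)=\sum_{\boldsymbol\nu}a^{\boldsymbol\nu}_{\boldsymbol\lambda\boldsymbol\mu}(n)K_{\boldsymbol\nu}(n)$. When $\|\boldsymbol\nu\|=\|\boldsymbol\lambda\|+\|\boldsymbol\mu\|$, $a^{\boldsymbol\nu}_{\boldsymbol\lambda\boldsymbol\mu}(n)$ is independent of $n\ge\|\boldsymbol\nu\|+\ell(\boldsymbol\nu^e)$ and is denoted $a^{\boldsymbol\nu}_{\boldsymbol\lambda\boldsymbol\mu}$. Let $\mathcal K_m\subset\mathscr Z_n(q)$ be the span of the $K_{\boldsymbol\lambda}(n)$ with $\|\boldsymbol\lambda\|\le m$ ($\mathcal K_{-1}=0$); this is a ring filtration, and $\mathscr G_n(q)=\bigoplus_{i\ge0}\mathcal K_i/\mathcal K_{i-1}$ is the associated graded ring, in which $K_{\boldsymbol\lambda}(n)$ denotes the image of $K_{\boldsymbol\lambda}(n)$ in degree $\|\boldsymbol\lambda\|$.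 Let $\mathscr G(q)$ be the free $\mathbb Z$-module with basis symbols $K_{\boldsymbol\lambda}$, $\boldsymbol\lambda\in\mathcal{P}(\Phi)$, graded by $\|\boldsymbol\lambda\|$, with multiplication $K_{\boldsymbol\lambda}K_{\boldsymbol\mu}=\sum_{\|\boldsymbol\nu\|=\|\boldsymbol\lambda\|+\|\boldsymbol\mu\|}a^{\boldsymbol\nu}_{\boldsymbol\lambda\boldsymbol\mu}K_{\boldsymbol\nu}$. *)

(* Defs.v *)
From HB Require Import structures.
From mathcomp Require Import all_boot all_order all_algebra.
From mathcomp Require Import finmap.
From Stdlib Require Import ClassicalEpsilon.

Set Implicit Arguments.
Unset Strict Implicit.
Unset Printing Implicit Defensive.

Import GRing.Theory.
Local Open Scope ring_scope.

Section GLnCenter.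

Variable F : finFieldType.

Definition inPhi (f : {poly F}) : Prop :=
  f \is monic /\ irreducible_poly f /\ f != 'X.

Definition is_partition (s : seq nat) : bool :=
  sorted geq s && all (fun k => 0 < k)%N s.

(* Raw finitely supported maps {poly F} -> partitions (default: empty
   partition).  P(Phi) is the set of valid ones. *)
Definition Raw := {fsfun {poly F} -> seq nat with [::]}.

Definition validP (l : Raw) : Prop :=
  forall f, f \in finsupp l -> inPhi f /\ is_partition (l f).

Definition norm (l : Raw) : nat :=
  (\sum_(f <- finsupp l) (size f).-1 * sumn (l f))%N.

Definition eigpart (l : Raw) : seq nat := l ('X - 1).
Definition lenE (l : Raw) : nat := size (eigpart l).

Definition modify (l : Raw) : Raw :=
  [fsfun f in finsupp l =>
     if f == 'X - 1 then [seq k <- map predn (l f) | (0 < k)%N] else l f].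

(* block-diagonal matrix of companion matrices of the given polynomials;
   companionmx p is the matrix of multiplication by t on F[t]/(p) in the
   basis 1, t, ..., t^(d-1), acting on row vectors. *)
Fixpoint bdiag (s : seq {poly F}) : {m : nat & 'M[F]_m} :=
  match s with
  | [::] => existT _ 0%N (0 : 'M[F]_0)
  | p :: s' =>
      existT (fun m => 'M[F]_m) ((size p).-1 + projT1 (bdiag s'))%N
        (block_mx (companionmx p) 0 0 (projT2 (bdiag s')))
  end.

Definition blocks (l : Raw) : seq {poly F} :=
  flatten [seq [seq f ^+ k | k <- l f] | f <- finsupp l].

(* g (acting on row vectors F^n by v |-> v *m g) has type lambda: the
   F[t]-module (F^n, g) is isomorphic to (+)_{f,i} F[t]/(f^(lambda_i(f))),
   i.e. there is a linear isomorphism P intertwining g with the model. *)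
Definition isType (n : nat) (g : 'M[F]_n) (l : Raw) : Prop :=
  validP l /\
  exists P : 'M[F]_(n, projT1 (bdiag (blocks l))),
    [&& row_free P & row_full P] /\ g *m P = P *m projT2 (bdiag (blocks l)).

Definition emptyRaw : Raw := [fsfun in fset0 => [::]].

(* the type of g (unique; chosen by classical choice) *)
Definition typeOf (n : nat) (g : 'M[F]_n) : Raw :=
  epsilon (inhabits emptyRaw) (isType g).

Definition modType (n : nat) (g : 'M[F]_n) : Raw := modify (typeOf g).

(* Z[G_n] realised as integer functions on n x n matrices, supported on
   GL_n(F) = unitmx; all elements used below vanish off GL_n. *)
Definition ZG (n : nat) := {ffun 'M[F]_n -> int}.

Definition mulZG (n : nat) (x y : ZG n) : ZG n :=
  [ffun g => \sum_(h : 'M[F]_n | h \in unitmx)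
               \sum_(k : 'M[F]_n | (k \in unitmx) && (h *m k == g))
                  x h * y k].

Definition oneZG (n : nat) : ZG n := [ffun g => if g == 1%:M then 1 else 0].

Definition Kc (n : nat) (mu : Raw) : ZG n :=
  [ffun g => if (g \in unitmx) && (modType g == mu) then 1 else 0].

Definition cls (n : nat) : seq Raw :=
  undup (map (@modType n) [seq g <- enum 'M[F]_n | g \in unitmx]).

(* x lies in K_(m-1) = span of K_rho(n) with ||rho|| < m  (K_(-1) = 0) *)
Definition inKlt (n m : nat) (x : ZG n) : Prop :=
  exists (s : seq Raw) (c : Raw -> int),
    (forall r, r \in s -> validP r) /\
    x = \sum_(r <- s | (norm r < m)%N) (Kc n r *~ c r).

(* a^nu_{lambda mu}(n): coefficient of K_nu(n) in K_lambda(n) K_mu(n),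
   i.e. the value of the product at any element of modified type nu
   (0 if K_nu(n) = 0). *)
Definition acoef (n : nat) (l mu nu : Raw) : int :=
  if [pick g : 'M[F]_n | (g \in unitmx) && (modType g == nu)] is Some g
  then mulZG (Kc n l) (Kc n mu) g else 0.

Definition astab (l mu nu : Raw) : int :=
  acoef (norm nu + lenE nu) l mu nu.

(* An element of G_n(q) is given by representatives X i in K_i of its
   homogeneous components in K_i / K_(i-1). *)
Definition GE (n : nat) := nat -> ZG n.

Definition GEwf (n : nat) (X : GE n) : Prop :=
  (forall i, inKlt i.+1 (X i)) /\ exists N, forall i, (N <= i)%N -> X i = 0.

Definition GEeq (n : nat) (X Y : GE n) : Prop :=
  forall i, inKlt i (X i - Y i).

Definition GEadd (n : nat) (X Y : GE n) : GE n := fun i => X i + Y i.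

Definition GEmul (n : nat) (X Y : GE n) : GE n :=
  fun k => \sum_(i < k.+1) mulZG (X i) (Y (k - i)%N).

Definition GEone (n : nat) : GE n := fun i => if i == 0%N then oneZG n else 0.

Definition GEemb (n : nat) (l : Raw) : GE n :=
  fun i => if i == norm l then Kc n l else 0.

Definition GQ := {fsfun Raw -> int with 0}.

Definition GQwf (x : GQ) : Prop := forall l, l \in finsupp x -> validP l.

(* all nu in P(Phi) with ||nu|| = m (each occurs in G_(2m)) *)
Definition ofNorm (m : nat) : seq Raw :=
  [seq nu <- cls (2 * m) | norm nu == m].

Definition GQbasis (l : Raw) : GQ := [fsfun r in [fset l]%fset => 1].

Definition GQadd (x y : GQ) : GQ :=
  [fsfun r in (finsupp x `|` finsupp y)%fset => x r + y r].

Definition GQmul (x y : GQ) : GQ :=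
  [fsfun nu in seq_fset tt
      (flatten [seq ofNorm (norm l + norm mu) | l <- finsupp x, mu <- finsupp y])
   => \sum_(l <- finsupp x) \sum_(mu <- finsupp y)
        x l * y mu * (if norm nu == (norm l + norm mu)%N then astab l mu nu else 0)].

Definition phi (n : nat) (x : GQ) : GE n :=
  fun i => \sum_(l <- finsupp x | norm l == i) (Kc n l *~ x l).

End GLnCenter.

(* Main.v *)
Require Import Defs.
From HB Require Import structures.
From mathcomp Require Import all_boot all_order all_algebra.
From mathcomp Require Import finmap zify ring.
From Stdlib Require Import Classical ClassicalEpsilon.
From Stdlib Require Import FunctionalExtensionality PropExtensionality.

Set Implicit Arguments.
Unset Strict Implicit.
Unset Printing Implicit Defensive.
Import GRing.Theory.
Local Open Scope ring_scope.

(* If [g] has modified type [nu], then [norm nu] is the rank of [g - 1]; this is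
   subadditive under products, so only elements [g] with
   rank (g - 1) = norm l + norm mu matter in the top degree.  If [h k = g] and the
   ranks of [h - 1] and [k - 1] add up to that of [g - 1], every row or column
   vector fixed by [g] is fixed by [h] and [k].  Hence a factorisation of
   [diag(g0, 1)] has both factors of the form [diag(h0, 1)], [diag(k0, 1)], and
   the coefficient does not depend on [n].  The type itself is controlled by the
   primary decomposition of an endomorphism, and its uniqueness by the nullities
   of the matrices [f^j(g)]. *)

(** * Similarity of matrices of possibly different nominal sizes *)

Section Similarity.
Variable F : fieldType.
Implicit Types p q f b : {poly F}.

(** Modification forgets how many parts of the partition at [t - 1] equal 1, and the size [n]
    restores this number. Hence elements of one [G_n] with equal modified types are conjugate, while
    an element and its extension by an identity block share a modified type. An identity in the
    graded ring is a congruence modulo [K_(i-1)] in each degree [i]. It is tested pointwise: a class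
    function lies in [K_(i-1)] exactly when it vanishes at all elements whose modified type has norm
    at least [i]. Products therefore have to be evaluated only in the top degree and above it. The
    size of the model matrix [bdiag] is computed from a list and is not convertible to [n], so
    intertwiners are rectangular matrices. Size 0 does occur, for an empty list of blocks;
    evaluation of polynomials is extended to it by the only possible value. *)

Definition phorner n : 'M[F]_n -> {poly F} -> 'M[F]_n :=
  if n is n'.+1 then fun A => horner_mx A else fun _ _ => 0.

Lemma phornerD n (A : 'M_n) (p q : {poly F}) : phorner A (p + q) = phorner A p + phorner A q.
Proof. by case: n A => [|n] A /=; rewrite ?addr0 ?rmorphD. Qed.

Lemma phornerM n (A : 'M_n) p q : phorner A (p * q) = phorner A p *m phorner A q.
Proof. by case: n A => [|n] A /=; rewrite ?mul0mx // rmorphM. Qed.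

Lemma phornerC n (A : 'M_n) c : phorner A c%:P = c%:M.
Proof. by case: n A => [|n] A /=; rewrite ?horner_mx_C // [_%:M]thinmx0. Qed.

Lemma phornerX n (A : 'M_n) : phorner A 'X = A.
Proof. by case: n A => [|n] A /=; rewrite ?horner_mx_X // [A]thinmx0. Qed.

Lemma phorner0 n (A : 'M_n) : phorner A 0 = 0.
Proof. by rewrite -[0 in LHS]polyC0 phornerC -[LHS]scalemx1 scale0r. Qed.

Lemma phorner1 n (A : 'M_n) : phorner A 1 = 1%:M.
Proof. by rewrite -[1 in LHS]polyC1 phornerC. Qed.

Lemma phornerN n (A : 'M_n) p : phorner A (- p) = - phorner A p.
Proof. by apply/eqP; rewrite -addr_eq0 -phornerD addNr phorner0. Qed.

Lemma phornerXsub1 n (A : 'M_n) : phorner A ('X - 1) = A - 1%:M.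
Proof. by rewrite phornerD phornerN phornerX phorner1. Qed.

Lemma phorner_mulX n (A : 'M_n) p : phorner A (p * 'X) = A *m phorner A p.
Proof. by rewrite mulrC phornerM phornerX. Qed.

Lemma phorner_coprime n (A : 'M_n) p q :
  coprimep p q -> exists u v, phorner A u *m phorner A p + phorner A v *m phorner A q = 1%:M.
Proof.
case/Bezout_eq1_coprimepP => [[u v]] /= e; exists u, v.
by rewrite -!phornerM -phornerD e phorner1.
Qed.

Lemma phorner_intertwine m n (A : 'M_m) (B : 'M_n) P p :
  A *m P = P *m B -> phorner A p *m P = P *m phorner B p.
Proof.
move=> AP; elim/poly_ind: p => [|p c IH]; first by rewrite !phorner0 mul0mx mulmx0.
rewrite !phornerD !phorner_mulX !phornerC mulmxDl mulmxDr -!mulmxA IH !mulmxA AP.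
by rewrite scalar_mxC.
Qed.

Lemma phorner_block m n (A : 'M_m) (B : 'M_n) p :
  phorner (block_mx A 0 0 B) p = block_mx (phorner A p) 0 0 (phorner B p).
Proof.
elim/poly_ind: p => [|p c IH]; first by rewrite !phorner0 -[LHS](block_mx0 F).
rewrite !phornerD !phorner_mulX !phornerC IH mulmx_block !mul0mx !mulmx0 !addr0.
by rewrite !add0r scalar_mx_block add_block_mx !addr0.
Qed.

Definition sim m n (A : 'M[F]_m) (B : 'M[F]_n) : Prop :=
  exists P : 'M[F]_(m, n), [&& row_free P & row_full P] /\ A *m P = P *m B.

Lemma isomxP m n (P : 'M[F]_(m, n)) :
  reflect (exists Q, P *m Q = 1%:M /\ Q *m P = 1%:M) (row_free P && row_full P).
Proof.
apply: (iffP andP) => [[/row_freeP [Q PQ] /row_fullP [R RP]]|[Q [PQ QP]]].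
  have e : R = Q by rewrite -[R]mulmx1 -PQ mulmxA RP mul1mx.
  by exists Q; rewrite -{2}e.
by split; [apply/row_freeP; exists Q | apply/row_fullP; exists Q].
Qed.

Lemma sim_dim m n (A : 'M[F]_m) (B : 'M[F]_n) : sim A B -> m = n.
Proof.
case=> P [/andP [/eqP e1 /eqP e2] _]; by rewrite -e1 -{2}e2.
Qed.

Lemma sim_refl n (A : 'M[F]_n) : sim A A.
Proof.
exists 1%:M; split; last by rewrite mulmx1 mul1mx.
by apply/isomxP; exists 1%:M; rewrite mulmx1.
Qed.

Lemma sim_sym m n (A : 'M[F]_m) (B : 'M[F]_n) : sim A B -> sim B A.
Proof.
case=> P [/isomxP [Q [PQ QP]] AP]; exists Q; split; first by apply/isomxP; exists P.
by rewrite -[B]mul1mx -QP -(mulmxA Q P) -AP -!mulmxA PQ mulmx1.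
Qed.

Lemma sim_trans m n k (B : 'M[F]_n) (A : 'M[F]_m) (C : 'M[F]_k) :
  sim A B -> sim B C -> sim A C.
Proof.
case=> P [/isomxP [P' [PP' P'P]] AP] [Q [/isomxP [Q' [QQ' Q'Q]] BQ]].
exists (P *m Q); split; last by rewrite mulmxA AP -mulmxA BQ mulmxA.
apply/isomxP; exists (Q' *m P'); split.
  by rewrite -mulmxA (mulmxA Q) QQ' mul1mx.
by rewrite -mulmxA (mulmxA P') P'P mul1mx.
Qed.

Lemma sim_block m n k l (A : 'M[F]_m) (B : 'M[F]_n) (C : 'M[F]_k) (D : 'M[F]_l) :
  sim A C -> sim B D -> sim (block_mx A 0 0 B) (block_mx C 0 0 D).
Proof.
case=> P [/isomxP [P' [PP' P'P]] AP] [Q [/isomxP [Q' [QQ' Q'Q]] BQ]].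
exists (block_mx P 0 0 Q); split; last first.
  by rewrite !mulmx_block !mul0mx !mulmx0 !addr0 !add0r AP BQ.
apply/isomxP; exists (block_mx P' 0 0 Q').
rewrite !mulmx_block !mul0mx !mulmx0 !addr0 !add0r PP' QQ' P'P Q'Q.
by rewrite -!scalar_mx_block.
Qed.

Lemma sim_blockC m n (A : 'M[F]_m) (B : 'M[F]_n) :
  sim (block_mx A 0 0 B) (block_mx B 0 0 A).
Proof.
exists (block_mx 0 1%:M 1%:M 0); split; last first.
  by rewrite !mulmx_block !mul0mx !mulmx0 !addr0 !add0r !mulmx1 !mul1mx.
apply/isomxP; exists (block_mx 0 1%:M 1%:M 0).
by rewrite !mulmx_block !mul0mx !mulmx0 !addr0 !add0r !mulmx1 -!scalar_mx_block.
Qed.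

Lemma sim_castmx m n (e : m = n) (A : 'M[F]_m) : sim A (castmx (e, e) A).
Proof. by case: n / e; rewrite castmx_id; apply: sim_refl. Qed.

Lemma sim_blockA m n k (A : 'M[F]_m) (B : 'M[F]_n) (C : 'M[F]_k) :
  sim (block_mx A 0 0 (block_mx B 0 0 C)) (block_mx (block_mx A 0 0 B) 0 0 C).
Proof.
have e : block_mx A 0 0 (block_mx B 0 0 C) =
    castmx (esym (addnA m n k), esym (addnA m n k)) (block_mx (block_mx A 0 0 B) 0 0 C).
  have := @block_mxA F _ _ _ _ _ _ A 0 0 0 B 0 0 0 C.
  by rewrite /= !row_mx0 !col_mx0.
rewrite e; apply: sim_sym; exact: sim_castmx.
Qed.

Definition nul n p (A : 'M[F]_n) : nat := (n - \rank (phorner A p))%N.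

Lemma sim_nul m n (A : 'M[F]_m) (B : 'M[F]_n) p : sim A B -> nul p A = nul p B.
Proof.
move=> s; have e := sim_dim s; case: s => P [/andP [fP uP] AP].
by rewrite /nul -(mxrankMfree _ fP) (phorner_intertwine p AP) (eqmxMfull _ uP) e.
Qed.

Lemma nul_block m n (A : 'M[F]_m) (B : 'M[F]_n) p :
  nul p (block_mx A 0 0 B) = (nul p A + nul p B)%N.
Proof.
rewrite /nul phorner_block rank_diag_block_mx.
have := rank_leq_row (phorner A p); have := rank_leq_row (phorner B p); lia.
Qed.

End Similarity.

(** * Companion matrices *)

Section Companion.
Variable F : fieldType.
Implicit Types p q f : {poly F}.

Lemma phorner_char n (A : 'M[F]_n) : phorner A (char_poly A) = 0.
Proof. by case: n A => [|n] A //=; apply: Cayley_Hamilton. Qed.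

Lemma phorner_companion p : p \is monic -> phorner (companionmx p) p = 0.
Proof. by move=> mp; have := phorner_char (companionmx p); rewrite companionmxK. Qed.

(** Only the last row of [companionmx p] carries coefficients of [p]. The top coordinate of [q] is
    zero, so that row is never met and the other rows merely shift. *)
Lemma poly_rV_companionX p q : (size q < (size p).-1)%N ->
  poly_rV q *m companionmx p = poly_rV (q * 'X).
Proof.
move=> sq; have qlast : q`_((size p).-2) = 0.
  by rewrite nth_default //; case: (_.-1) sq.
apply/rowP => j; rewrite !mxE coefMX.
under eq_bigr => i _ do rewrite !mxE.
case: eqP => [j0|/eqP jn0].
  apply: big1 => i _; case: eqP => [->|_]; last by rewrite j0 mulr0.
  by rewrite qlast mul0r.
have lt_j : (j.-1 < (size p).-1)%N by apply: leq_ltn_trans (ltn_ord j); apply: leq_pred.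
rewrite (bigD1 (Ordinal lt_j)) //= big1 ?addr0 => [|i ni]; last first.
  case: eqP => [->|_]; first by rewrite qlast mul0r.
  case: eqP => [e|]; last by rewrite mulr0.
  by case/eqP: ni; apply: val_inj => /=; rewrite -e.
rewrite ifF ?prednK ?eqxx ?mulr1 ?lt0n //.
apply/negP => /eqP e; have := ltn_ord j.
by move: jn0 e; case: (nat_of_ord j) => // m _ /= ->; case: ((size p).-1) => //= k; rewrite ltnn.
Qed.

Lemma poly_rV_companion p q : (size q <= (size p).-1)%N ->
  poly_rV 1 *m phorner (companionmx p) q = poly_rV q.
Proof.
elim/poly_ind: q => [|q c IH]; first by rewrite phorner0 mulmx0 linear0.
rewrite size_MXaddC; case: ifP => [/andP [/eqP -> /eqP ->] _|_ sq].
  by rewrite mul0r add0r phorner0 mulmx0 linear0.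
rewrite phornerD phornerM phornerX phornerC mulmxDr mulmxA IH 1?ltnW //.
rewrite poly_rV_companionX // mul_mx_scalar linearD /=; congr (_ + _).
by rewrite -[c%:P]mulr1 mul_polyC linearZ.
Qed.

(** The row space of [q] evaluated at the companion matrix contains all multiples of [q] of degree
    below [d], a space of dimension [d - deg q] when [deg q <= d]; otherwise the bound is
    trivial. *)
Lemma nul_companion_le p q : q != 0 -> (nul q (companionmx p) <= (size q).-1)%N.
Proof.
move=> q0; rewrite /nul; set d := (size p).-1; set C := phorner _ _.
case: (leqP (size q) d.+1) => sq; last by lia.
pose M := lin1_mx (@poly_rV F d \o q \o* (@rVpoly F (d - (size q).-1))).
have ME u : u *m M = poly_rV (rVpoly u * q) by rewrite mul_rV_lin1.
have sM (u : 'rV_(d - (size q).-1)) : (size (rVpoly u * q)%R <= d)%N.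
  have aux (a b e : nat) : (0 < b -> b <= e.+1 -> a <= e - b.-1 -> (a + b).-1 <= e)%N by lia.
  apply: leq_trans (size_polyMleq _ _) _; apply: aux => //; first by rewrite size_poly_gt0.
  exact: size_poly.
have fM : row_free M.
  apply: inj_row_free => u; rewrite ME => /(congr1 rVpoly).
  rewrite poly_rV_K // linear0 => /eqP; rewrite mulf_eq0 (negPf q0) orbF => /eqP u0.
  by rewrite -[u]rVpolyK u0 linear0.
have : (M <= C)%MS.
  apply/rV_subP => _ /submxP [u ->]; rewrite ME -poly_rV_companion //.
  by rewrite phornerM mulmxA submxMl.
by move/mxrankS; move: fM => /eqP ->; lia.
Qed.

Lemma nulM n (A : 'M[F]_n) p q : (nul (p * q) A <= nul p A + nul q A)%N.
Proof.
rewrite /nul phornerM; have := mxrank_mul_min (phorner A p) (phorner A q).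
by have := rank_leq_row (phorner A p); have := rank_leq_row (phorner A q); lia.
Qed.

Lemma nul_phorner0 n (A : 'M[F]_n) p : phorner A p = 0 -> nul p A = n.
Proof. by rewrite /nul => ->; rewrite mxrank0 subn0. Qed.

Lemma nul_coprime n (A : 'M[F]_n) p q :
  coprimep p q -> phorner A q = 0 -> nul p A = 0%N.
Proof.
move=> /(phorner_coprime A) [u [v e]] q0; move: e; rewrite q0 mulmx0 addr0 => e.
have /eqP rk : row_full (phorner A p) by apply/row_fullP; exists (phorner A u).
by rewrite /nul rk subnn.
Qed.

(** For [j <= k], the upper bounds for [f^j] and [f^(k-j)] add up to the full nullity of [f^k], so
    subadditivity of nullity forces both to be equalities. *)
Lemma nul_primary f j k : f \is monic ->
  nul (f ^+ j) (companionmx (f ^+ k)) = ((size f).-1 * minn j k)%N.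
Proof.
move=> mf; have C0 : phorner (companionmx (f ^+ k)) (f ^+ k) = 0.
  by apply: phorner_companion; apply: monic_exp.
have nk : nul (f ^+ k) (companionmx (f ^+ k)) = ((size f).-1 * k)%N.
  by rewrite nul_phorner0 // size_exp.
have ub i : (nul (f ^+ i) (companionmx (f ^+ k)) <= (size f).-1 * i)%N.
  by rewrite -size_exp nul_companion_le // expf_neq0 // monic_neq0.
case: (leqP j k) => jk; last first.
  rewrite nul_phorner0 ?size_exp // -(subnK (ltnW jk)) exprD phornerM C0 mulmx0 //.
have := nulM (companionmx (f ^+ k)) (f ^+ j) (f ^+ (k - j)).
rewrite -exprD subnKC // nk; have := ub j; have := ub (k - j)%N.
have : ((size f).-1 * k = (size f).-1 * j + (size f).-1 * (k - j))%N.
  by rewrite -mulnDr subnKC.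
lia.
Qed.

Lemma nul1 n (A : 'M[F]_n) : nul 1 A = 0%N.
Proof. by rewrite /nul phorner1 mxrank1 subnn. Qed.

End Companion.

(** * Cyclic primary summands *)

Section Cyclic.
Variable F : fieldType.
Implicit Types p q f : {poly F}.

Lemma irreducible_factor p : (1 < size p)%N ->
  exists f, [/\ f \is monic, irreducible_poly f & f %| p].
Proof.
have [m] := ubnP (size p); elim: m p => // m IH p /ltnSE sm sp.
have [irr|nirr] := classic (irreducible_poly p).
  have lp0 : lead_coef p != 0 by rewrite lead_coef_eq0; apply: irredp_neq0.
  have e : (lead_coef p)^-1 *: p %= p by rewrite eqp_scale ?invr_eq0.
  exists ((lead_coef p)^-1 *: p); split.
  - by apply/monicP; rewrite lead_coefZ mulVf.
  - split=> [|q sq]; first by rewrite (eqp_size e).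
    by rewrite (eqp_dvdr _ e) => /(irr.2 _ sq) /eqp_trans; apply; rewrite eqp_sym.
  - by rewrite (eqp_dvdl _ e).
have [q [sq qp nqp]] : exists q, [/\ size q != 1%N, q %| p & ~~ (q %= p)].
  apply: NNPP => nex; apply: nirr; split=> // q sq qp.
  by apply/negPn/negP => nqp; apply: nex; exists q.
have p0 : p != 0 by rewrite -size_poly_gt0 ltnW.
have q0 : q != 0 by apply: contraTneq qp => ->; rewrite dvd0p.
have lt_qp : (size q < size p)%N.
  rewrite ltn_neqAle dvdp_leq // andbT; apply: contraNneq nqp => e.
  by rewrite -dvdp_size_eqp // e.
have [||f [mf irrf fq]] := IH q; first exact: leq_trans sm.
  by rewrite ltn_neqAle eq_sym sq size_poly_gt0.
by exists f; split=> //; apply: dvdp_trans qp.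
Qed.

Lemma multiplicity_factor f p : (1 < size f)%N -> p != 0 ->
  exists k q, p = f ^+ k * q /\ ~~ (f %| q).
Proof.
move=> sf; have f0 : f != 0 by rewrite -size_poly_gt0 ltnW.
have [m] := ubnP (size p); elim: m p => // m IH p /ltnSE sm p0.
have [fp|nfp] := boolP (f %| p); last by exists 0%N, p; rewrite expr0 mul1r.
have pE := divpK fp; have q0 : p %/ f != 0 by apply: contraNneq p0 => q0; rewrite -pE q0 mul0r.
have [||k [q [e nq]]] := IH (p %/ f) => //.
  apply: leq_trans sm; rewrite size_divp //.
  have : (0 < size p)%N by rewrite size_poly_gt0.
  move: sf; case: (size f) => [|[|a]] //= _.
  by case: (size p) => // b _; rewrite subSS ltnS leq_subr.
by exists k.+1, q; rewrite -pE {1}e exprSr mulrAC.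
Qed.

Lemma phorner_tr n (A : 'M[F]_n) p : phorner A^T p = (phorner A p)^T.
Proof.
elim/poly_ind: p => [|p c IH]; first by rewrite !phorner0 trmx0.
rewrite !phornerD [in LHS]phorner_mulX phornerM phornerX !phornerC IH.
by rewrite linearD /= trmx_mul tr_scalar_mx.
Qed.

Lemma phornerZ n (A : 'M[F]_n) c p : phorner A (c *: p) = c *: phorner A p.
Proof. by rewrite -mul_polyC phornerM phornerC mul_scalar_mx. Qed.

Definition krylov d n (g : 'M[F]_n) (v : 'rV[F]_n) : 'M[F]_(d, n) :=
  \matrix_(i < d) (v *m phorner g 'X^i).

Lemma mul_krylov d n (g : 'M[F]_n) v (u : 'rV_d) :
  u *m krylov d g v = v *m phorner g (rVpoly u).
Proof.
rewrite mulmx_sum_row /rVpoly poly_def.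
rewrite (big_morph _ (phornerD g) (phorner0 g)) mulmx_sumr.
apply: eq_bigr => i _; rewrite rowK phornerZ -scalemxAr; congr (_ *: _).
by rewrite valK.
Qed.

(** The rows [v g^i] span the cyclic submodule generated by [v], a quotient of [F[t]/(p)]. Their
    independence is a separate matter, settled by the Hankel matrix. *)
Lemma krylov_companion p n (g : 'M[F]_n) v : p \is monic -> v *m phorner g p = 0 ->
  krylov (size p).-1 g v *m g = companionmx p *m krylov (size p).-1 g v.
Proof.
move=> mp vp; apply/row_matrixP => i; rewrite !row_mul rowK mul_krylov.
rewrite -mulmxA -{2}(phornerX g) -phornerM -exprSr.
case: (boolP (i == (size p).-2 :> nat)) => il.
  (* The last row of the companion matrix is the remainder of [t^d] modulo the monic [p] of degree
     [d]. *)
  have -> : rVpoly (row i (companionmx p)) = 'X^(i.+1) - p.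
    have iE : i.+1 = (size p).-1 by rewrite (eqP il); case: ((size p).-1) i {il} => // -[].
    apply/polyP => j; rewrite coef_rVpoly coefB coefXn iE.
    case: insubP => [j' _ <-|]; first by rewrite !mxE il ltn_eqF ?sub0r // ltn_ord.
    rewrite -leqNgt leq_eqVlt => /orP [/eqP <-|lt_j].
      by rewrite eqxx -(monicP mp) subrr.
    rewrite gtn_eqF // nth_default ?subrr //.
    by move: lt_j; case: (size p).
  by rewrite phornerD phornerN mulmxDr mulmxN vp subr0.
congr (v *m phorner g _); apply/polyP => j; rewrite coef_rVpoly coefXn.
case: insubP => [j' _ <-|]; first by rewrite !mxE (negPf il) eq_sym.
rewrite -leqNgt => le_j; case: eqP => // jE; case/eqP: il.
have e : (size p).-1 = i.+1 by apply/eqP; rewrite eqn_leq -{1}jE le_j ltn_ord.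
by rewrite (congr1 predn e).
Qed.

(* The Hankel matrix [v g^(i+j) w^T] is invertible: if [u] is in its kernel and
   [r <> 0] is the polynomial of [u], some multiple of [r] is [f^k] modulo
   [f^(k+1)], contradicting [v f^k(g) w^T <> 0]. *)
Lemma krylov_hankel f k n (g : 'M[F]_n) (v w : 'rV[F]_n)
    (d := (size (f ^+ k.+1)).-1) :
  irreducible_poly f ->
  w *m phorner g^T (f ^+ k.+1) = 0 -> v *m phorner g (f ^+ k.+1) = 0 ->
  v *m phorner g (f ^+ k) *m w^T != 0 ->
  row_free (krylov d g v *m (krylov d g^T w)^T).
Proof.
move=> irrf w0 v0 nz; apply: inj_row_free => u; rewrite mulmxA mul_krylov => u0.
set r := rVpoly u in u0; have [r0|rn0] := eqVneq r 0.
  by rewrite -[u]rVpolyK -/r r0 linear0.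
have sd : (0 < size (f ^+ k.+1))%N by rewrite size_poly_gt0 expf_neq0 // irredp_neq0.
(* The hypothesis on [u] tests only powers of [g] below [d]. Since [f^(k+1)] annihilates [w],
   reducing [s] modulo [f^(k+1)] extends this to all [s]. *)
have vr s : v *m phorner g r *m phorner g s *m w^T = 0.
  rewrite -mulmxA.
  have sE := divp_eq s (f ^+ k.+1); set s' := s %% _ in sE.
  have -> : phorner g s *m w^T = phorner g s' *m w^T.
    rewrite sE phornerD mulmxDl phornerM -mulmxA.
    by rewrite -[_ *m w^T]trmxK trmx_mul trmxK -phorner_tr w0 trmx0 mulmx0 add0r.
  have ss' : (size s' <= d)%N.
    by rewrite /d -ltnS prednK // ltn_modp -size_poly_gt0.
  have := mul_krylov g^T w (poly_rV s' : 'rV_d); rewrite poly_rV_K // phorner_tr => e.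
  have -> : phorner g s' *m w^T = (krylov d g^T w)^T *m (poly_rV s' : 'rV_d)^T.
    by rewrite -trmx_mul e trmx_mul trmxK.
  by rewrite mulmxA u0 mul0mx.
have [j [t [rE nft]]] := multiplicity_factor irrf.1 rn0.
have le_jk : (j <= k)%N.
  rewrite leqNgt; apply/negP => lt_kj.
  have : f ^+ k.+1 %| r by rewrite rE -(subnK lt_kj) exprD -mulrA mulrCA dvdp_mulr.
  move/(dvdp_leq rn0); rewrite leqNgt => /negP; apply.
  by rewrite -(prednK sd) ltnS; apply: size_poly.
have cop : coprimep t (f ^+ k.+1).
  by rewrite coprimep_sym coprimep_expl // irreducible_poly_coprime.
case/Bezout_eq1_coprimepP: cop => -[a b] /= ab.
have e : r * (a * f ^+ (k - j)) = f ^+ k - f ^+ k.+1 * (b * f ^+ k).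
  have at_ : a * t = 1 - b * f ^+ k.+1 by rewrite -ab addrK.
  transitivity (a * t * (f ^+ j * f ^+ (k - j))); first by rewrite rE; ring.
  by rewrite at_ -exprD subnKC //; ring.
case/eqP: nz; have := vr (a * f ^+ (k - j)).
rewrite -(mulmxA v) -phornerM e phornerD phornerN phornerM mulmxDr mulmxN.
by rewrite (mulmxA v (phorner g (f ^+ k.+1))) v0 mul0mx subr0.
Qed.

(** Let [K] be the Krylov matrix of [v] and [L] the transposed Krylov matrix of [w]. Invertibility
    of [K L] makes the row space of [K] a complement of the left kernel of [L]. Both spaces are
    stable under [g], and on the first one [g] acts as the companion matrix. *)
Lemma split_cyclic f k n (g : 'M[F]_n) (v w : 'rV[F]_n) :
  irreducible_poly f -> f \is monic ->
  v *m phorner g (f ^+ k.+1) = 0 -> w *m phorner g^T (f ^+ k.+1) = 0 ->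
  v *m phorner g (f ^+ k) *m w^T != 0 ->
  exists r (g' : 'M[F]_r), sim g (block_mx (companionmx (f ^+ k.+1)) 0 0 g').
Proof.
move=> irrf mf v0 w0 nz; have mp : f ^+ k.+1 \is monic by apply: monic_exp.
have := krylov_hankel irrf w0 v0 nz.
have := krylov_companion mp v0; have := krylov_companion mp w0.
move: (krylov _ g v) (krylov _ g^T w); set C := companionmx _; move: C.
set d := (size (f ^+ k.+1)).-1 => C K L' L'g Kg KL; pose L := L'^T.
have gL : g *m L = L *m C^T by rewrite /L -trmx_mul -L'g trmx_mul trmxK.
pose W := row_base (kermx L).
have WL : W *m L = 0.
  by apply/sub_kermxP; rewrite eq_row_base.
have [g' Wg] : exists g', W *m g = g' *m W.
  apply/submxP; rewrite eq_row_base; apply/sub_kermxP.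
  by rewrite -mulmxA gL mulmxA WL mul0mx.
exists _, g'; apply: sim_sym; exists (col_mx K W); split; last first.
  by rewrite mul_block_col !mul0mx addr0 add0r mul_col_mx -Kg -Wg.
have fP : row_free (col_mx K W).
  apply: inj_row_free => u; rewrite -[u]hsubmxK mul_row_col => e.
  have a0 : lsubmx u = 0.
    apply: (row_free_inj KL); rewrite mul0mx mulmxA.
    move/(congr1 (mulmx^~ L)): e; rewrite mulmxDl mul0mx -[X in _ + X]mulmxA WL.
    by rewrite mulmx0 addr0.
  move: e; rewrite a0 mul0mx add0r => b0.
  have -> : rsubmx u = 0.
    by apply: (row_free_inj (row_base_free (kermx L))); rewrite mul0mx.
  by rewrite row_mx0.
rewrite fP; move: fP; rewrite /row_free /row_full => /eqP ->.
rewrite mxrank_ker; have /row_fullP/eqP : exists B, B *m L = 1%:M.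
  move: KL; rewrite row_free_unit => /mulVmx KL; exists (invmx (K *m L) *m K).
  by rewrite -mulmxA.
move=> rL; have := rank_leq_row L; rewrite rL => le_dn.
by rewrite subnKC //=.
Qed.

Lemma split_primary n (g : 'M[F]_n.+1) : exists f k r (g' : 'M[F]_r),
  [/\ f \is monic, irreducible_poly f & sim g (block_mx (companionmx (f ^+ k.+1)) 0 0 g')].
Proof.
pose p := mxminpoly g; have mp : p \is monic by apply: mxminpoly_monic.
have [f [mf irrf fp]] : exists f, [/\ f \is monic, irreducible_poly f & f %| p].
  by apply: irreducible_factor; rewrite size_mxminpoly ltnS; apply: mxminpoly_nonconstant.
have [k [q [pE nfq]]] := multiplicity_factor irrf.1 (monic_neq0 mp).
case: k => [|k] in pE; first by move: fp; rewrite pE expr0 mul1r (negPf nfq).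
(* Otherwise the minimal polynomial [f^(k+1) q] would divide [q f^k q], and [f] would divide [q].
   The two copies of [q] serve row [i] and column [j] of [q(g)]: each of these vectors needs one to
   be killed by [f^(k+1)]. *)
have [i [j Mij]] : exists i j, phorner g (q * f ^+ k * q) i j != 0.
  apply: NNPP => nex; have M0 : horner_mx g (q * f ^+ k * q) = 0.
    apply/matrixP => i j; rewrite [RHS]mxE; apply/eqP/negPn/negP => nz.
    by apply: nex; exists i, j.
  have := mxminpoly_min M0; rewrite -/p pE.
  have -> : f ^+ k.+1 * q = (f ^+ k * q) * f by rewrite exprS -mulrA mulrC.
  have -> : q * f ^+ k * q = (f ^+ k * q) * q by rewrite (mulrC q (f ^+ k)).
  rewrite dvdp_mul2l ?(negPf nfq) // mulf_neq0 ?expf_neq0 //; first exact: irredp_neq0.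
  by apply: contraNneq nfq => ->; rewrite dvdp0.
have p0 : phorner g p = 0 by apply: mx_root_minpoly.
exists f, k; have [|||r [g' s]] := @split_cyclic f k n.+1 g
  (row i (phorner g q)) (col j (phorner g q))^T irrf mf.
- by rewrite -row_mul -phornerM mulrC -pE p0 row0.
- by rewrite phorner_tr -trmx_mul colE mulmxA -phornerM -pE p0 mul0mx trmx0.
- apply: contraNneq Mij; rewrite trmxK -row_mul -phornerM colE mulmxA -row_mul -colE -phornerM.
  by move/matrixP/(_ 0 0); rewrite !mxE => ->.
by exists r, g'.
Qed.

End Cyclic.

(** * Existence of types *)

Section BlockDiagonal.
Variable F : finFieldType.
Implicit Types p q f b : {poly F}.
Implicit Types s t : seq {poly F}.

Local Notation bdmx s := (projT2 (bdiag s)).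

Lemma sim_block0 n (A : 'M[F]_n) : sim A (block_mx (0 : 'M_0) 0 0 A).
Proof.
exists (row_mx (0 : 'M_(n, 0)) 1%:M); split; last first.
  by rewrite mul_mx_row mul_row_block !mulmx0 mulmx1 mul1mx addr0 add0r.
have fP : row_free (row_mx (0 : 'M[F]_(n, 0)) 1%:M).
  by apply/row_freeP; exists (col_mx 0 1%:M); rewrite mul_row_col mul0mx add0r mulmx1.
by rewrite fP /row_full (eqP fP) eqxx.
Qed.

Lemma sim_bdiag_cat s t : sim (bdmx (s ++ t)) (block_mx (bdmx s) 0 0 (bdmx t)).
Proof.
elim: s => [|p s IH] /=; first exact: sim_block0.
by apply: sim_trans (sim_blockA _ _ _); apply: sim_block IH; apply: sim_refl.
Qed.

Lemma sim_bdiag_perm s t : perm_eq s t -> sim (bdmx s) (bdmx t).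
Proof.
elim: s t => [|p s IH] t st.
  have /nilP -> : nilp t by rewrite /nilp -(perm_size st).
  exact: sim_refl.
have pt : p \in t by rewrite -(perm_mem st) mem_head.
case/splitPr: pt st => t1 t2 st.
have st' : perm_eq s (t1 ++ t2) 
  by rewrite -(perm_cons p); apply: (perm_trans st); rewrite -cat1s perm_catCA.
apply: sim_trans (sim_sym (sim_bdiag_cat t1 (p :: t2))) => /=.
apply: sim_trans (sim_sym (sim_blockA _ _ _)).
apply: sim_trans (sim_block (sim_blockC _ _) (sim_refl _)).
apply: sim_trans (sim_blockA _ _ _); apply: sim_block; first exact: sim_refl.
exact: sim_trans (IH _ st') (sim_bdiag_cat _ _).
Qed.

Lemma nul_bdiag p s : nul p (bdmx s) = (\sum_(b <- s) nul p (companionmx b))%N.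
Proof.
elim: s => [|b s IH] /=; last by rewrite big_cons nul_block IH.
by rewrite big_nil /nul sub0n.
Qed.

Lemma bdiag_dim s : projT1 (bdiag s) = (\sum_(b <- s) (size b).-1)%N.
Proof. by elim: s => [|b s IH] /=; rewrite ?big_nil // big_cons IH. Qed.

Lemma size_Xsub1 : size ('X - 1 : {poly F}) = 2.
Proof. by rewrite -[1]polyC1 size_XsubC. Qed.

Lemma monic_Xsub1 : ('X - 1 : {poly F}) \is monic.
Proof. by rewrite -[1]polyC1 monicXsubC. Qed.

Lemma inPhi_Xsub1 : inPhi ('X - 1 : {poly F}).
Proof.
split; first exact: monic_Xsub1.
split; first by rewrite -[1]polyC1; apply: irredp_XsubC.
apply/eqP => /(congr1 (horner^~ 0)) /eqP.
by rewrite hornerD hornerN hornerX hornerC sub0r oppr_eq0 oner_eq0.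
Qed.

Lemma bdiag_nseq c : bdmx (nseq c ('X - 1 : {poly F})) = 1%:M.
Proof.
elim: c => [|c IH] /=; first by apply/matrixP => -[].
rewrite IH scalar_mx_block; congr block_mx.
by apply/eqP; rewrite -subr_eq0 -phornerXsub1 phorner_companion ?monic_Xsub1.
Qed.

Definition primes_of (s : seq ({poly F} * nat)) := [seq x.1 ^+ x.2 | x <- s].

Lemma primary_decomposition n (g : 'M[F]_n) : exists s : seq ({poly F} * nat),
  (forall x, x \in s -> [/\ x.1 \is monic, irreducible_poly x.1 & (0 < x.2)%N]) /\
  sim g (bdmx (primes_of s)).
Proof.
have [m] := ubnP n; elim: m n g => // m IH [|n] g /ltnSE sm.
  by exists [::]; split=> //=; rewrite [g]thinmx0; apply: sim_refl.
have [f [k [r [g' [mf irrf sg]]]]] := split_primary g.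
have dim := sim_dim sg; rewrite size_exp in dim.
have d_gt0 : (0 < (size f).-1)%N by rewrite -ltnS prednK ?irrf.1 // ltnW ?irrf.1.
have [|s [ps ss]] := IH r g'.
  by apply: leq_trans sm; rewrite dim mulnS -{1}[r]add0n ltn_add2r addn_gt0 d_gt0.
exists ((f, k.+1) :: s); split=> [x|/=].
  by rewrite inE => /orP [/eqP ->|/ps].
by apply: sim_trans sg _; apply: sim_block ss; apply: sim_refl.
Qed.

Lemma unitmx_nul n (g : 'M[F]_n) : (g \in unitmx) = (nul 'X g == 0%N).
Proof.
rewrite /nul phornerX subn_eq0 -row_free_unit /row_free eqn_leq.
by rewrite rank_leq_row.
Qed.

Lemma sum_finsupp (l : Raw F) (S : {fset {poly F}}) (G : {poly F} -> seq nat -> nat) :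
  (forall f, G f [::] = 0%N) -> (finsupp l `<=` S)%fset ->
  (\sum_(f <- finsupp l) G f (l f) = \sum_(f <- S) G f (l f))%N.
Proof.
move=> G0 lS; apply: big_fset_incl => // f _ nf.
by rewrite fsfun_dflt.
Qed.

Lemma sum_blocks (l : Raw F) (G : {poly F} -> nat) :
  (\sum_(b <- blocks l) G b = \sum_(f <- finsupp l) \sum_(k <- l f) G (f ^+ k))%N.
Proof.
rewrite /blocks big_flatten big_map; apply: eq_bigr => f _.
by rewrite big_map.
Qed.

(** Grouping a primary decomposition by polynomial and sorting the exponents only permutes the
    blocks. Invertibility excludes the polynomial [t]. *)
Lemma isType_exists n (g : 'M[F]_n) : g \in unitmx -> exists l, isType g l.
Proof.
rewrite unitmx_nul => /eqP ug; have [s [ps sg]] := primary_decomposition g.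
pose l : Raw F := [fsfun f in seq_fset tt [seq x.1 | x <- s] =>
   sort geq [seq x.2 | x <- s & x.1 == f]].
have lE f : l f = sort geq [seq x.2 | x <- s & x.1 == f].
  rewrite fsfun_fun seq_fsetE; case: ifP => // nf.
  suff -> : [seq x <- s | x.1 == f] = [::] by [].
  apply/eqP; rewrite -(negbK (_ == _)) -has_filter; apply/hasPn => x xs /=.
  by apply: contraFN nf => /eqP <-; apply: map_f.
have ml f k : (k \in l f) = ((f, k) \in s).
  rewrite lE mem_sort; apply/mapP/idP => [[[h j]]|fk].
    by rewrite mem_filter /= => /andP [/eqP -> hs] ->.
  by exists (f, k); rewrite ?mem_filter ?eqxx.
have ms f : (f \in finsupp l) = (f \in [seq x.1 | x <- s]).
  rewrite mem_finsupp; apply/idP/mapP => [|[[h k] hs ->]].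
    case e : (l f) => [//|k r] _; exists (f, k) => //; by rewrite -ml e mem_head.
  by apply/eqP => e; move: hs; rewrite -ml e.
have bl : perm_eq (blocks l) (primes_of s).
  apply/permP => a; rewrite -!sum1_count big_mkcond sum_blocks big_map [RHS]big_mkcond.
  under eq_bigr => f _.
    rewrite (perm_big [seq x.2 | x <- s & x.1 == f]) ?lE ?perm_sort //=.
    rewrite big_map big_filter big_mkcond; over.
  rewrite exchange_big [LHS]big_seq_cond [RHS]big_seq_cond /=; apply: eq_bigr => x.
  rewrite andbT => xs.
  rewrite (bigD1_seq x.1) ?fset_uniq ?ms ?map_f //= eqxx big1 ?addn0 // => f nf.
  by rewrite eq_sym (negPf nf).
exists l; split; last by apply: sim_trans sg _; apply: sim_bdiag_perm; rewrite perm_sym.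
move=> f; rewrite ms => /mapP [x xs ->]; have [mx irrx x2] := ps x xs; split; last first.
  rewrite /is_partition lE sort_sorted; last by move=> a b; apply: leq_total.
  apply/allP => k; rewrite mem_sort => /mapP [y].
  by rewrite mem_filter => /andP [_ /ps []] _ _ ? ->.
(* A block at [t] would contribute [min(1, k) = 1] to the nullity of [g] itself. *)
split=> //; split=> //; apply/eqP => xX; move: ug; rewrite (sim_nul _ sg) nul_bdiag big_map.
move/eqP; rewrite sum_nat_seq_eq0 => /allP /(_ x xs) /=.
by rewrite -xX -[X in nul X _]expr1 nul_primary // (minn_idPl x2) xX size_polyX.
Qed.

Lemma typeOfP n (g : 'M[F]_n) : g \in unitmx -> isType g (typeOf g).
Proof. by move/isType_exists; apply: epsilon_spec. Qed.

(** Similar matrices satisfy the same predicate [isType]; by extensionality the two predicates are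
    equal, so the choice operator returns the same value. Uniqueness of types is not invoked. *)
Lemma sim_typeOf m n (g : 'M[F]_m) (h : 'M[F]_n) : sim g h -> typeOf g = typeOf h.
Proof.
move=> s; rewrite /typeOf; congr epsilon; apply: functional_extensionality => l.
apply: propositional_extensionality; split=> -[vl sl]; split=> //.
  exact: sim_trans (sim_sym s) sl.
exact: sim_trans s sl.
Qed.

End BlockDiagonal.

(** * Modified types *)

Section ModifiedType.
Variable F : finFieldType.
Implicit Types f : {poly F}.
Implicit Types l nu : Raw F.

Local Notation bdmx s := (projT2 (bdiag s)).
Local Notation X1 := ('X - 1 : {poly F}).

Definition modpart (s : seq nat) := [seq k <- map predn s | (0 < k)%N].

(** The number of parts exceeding [j] is a part of the conjugate partition, and multiplicities are
    differences of consecutive such numbers. Nullities give access to a partition in exactly this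
    form. *)
Lemma count_mem_partition s k : is_partition s ->
  count_mem k s = (if k is j.+1 then count (ltn j) s - count (ltn k) s else 0)%N.
Proof.
case/andP => _ /allP s_gt0; case: k => [|j].
  by apply/count_memPn/negP => /s_gt0.
have -> : count (ltn j) s = (count_mem j.+1 s + count (ltn j.+1) s)%N.
  rewrite -count_predUI -[LHS]addn0; congr (_ + _)%N.
    by apply: eq_count => i /=; rewrite (leq_eqVlt j.+1) eq_sym.
  apply/esym/eqP; rewrite -leqn0 leqNgt -has_count.
  by apply/hasPn => i _ /=; case: eqP => [->|//]; rewrite ltnn.
by rewrite addnK.
Qed.

Lemma partition_eq s t : is_partition s -> is_partition t ->
  (forall j, count (ltn j) s = count (ltn j) t) -> s = t.
Proof.
move=> ps pt e; apply: (@sorted_eq _ geq).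
- by move=> a b c ba cb; apply: leq_trans cb ba.
- by move=> a b; rewrite andbC; apply: anti_leq.
- by case/andP: ps.
- by case/andP: pt.
- apply/allP => k _ /=; rewrite !count_mem_partition //.
  by case: k => // j; rewrite !e.
Qed.

(** Modification removes the first column of the Young diagram, hence the shift of the index. *)
Lemma count_modpart s j : count (ltn j) (modpart s) = count (ltn j.+1) s.
Proof.
rewrite /modpart count_filter count_map; apply: eq_count => -[|[|i]] //=.
by rewrite andbT.
Qed.

Lemma modpart_partition s : is_partition s -> is_partition (modpart s).
Proof.
case/andP => ss _; apply/andP; split; last by apply: filter_all.
apply: sorted_filter; first by move=> a b c ba cb; apply: leq_trans cb ba.
rewrite sorted_map; apply: sub_sorted ss => a b /=.
by case: a b => [|a] [|b].
Qed.

Lemma sumn_modpart s : is_partition s -> sumn s = (sumn (modpart s) + size s)%N.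
Proof.
case/andP => _; elim: s => //= -[|k] s IH //= /IH ->.
case: k => [|k] /=; by rewrite addnS ?add1n ?addSn ?addnA.
Qed.

Lemma count_gt0 s : is_partition s -> count (ltn 0) s = size s.
Proof. by case/andP => _; rewrite all_count => /eqP. Qed.

Lemma size_modpart s : is_partition s -> size (modpart s) = count (ltn 1) s.
Proof. by move=> ps; rewrite -count_modpart count_gt0 // modpart_partition. Qed.

Lemma validP_partition l f : validP l -> is_partition (l f).
Proof.
move=> vl; have [/vl []//|nf] := boolP (f \in finsupp l).
by rewrite fsfun_dflt.
Qed.

Lemma validP_notin l f : validP l -> ~ inPhi f -> l f = [::].
Proof.
move=> vl nf; have [/vl []//|] := boolP (f \in finsupp l).
by move/fsfun_dflt.
Qed.

Lemma modifyE l f : modify l f = if f == X1 then modpart (l f) else l f.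
Proof.
rewrite /modify fsfun_fun; case: ifP => // /negbT nf.
by rewrite fsfun_dflt //; case: ifP.
Qed.

Lemma finsupp_modify l : (finsupp (modify l) `<=` finsupp l)%fset.
Proof.
apply/fsubsetP => f; rewrite !mem_finsupp modifyE; apply: contraNneq => ->.
by case: ifP.
Qed.

Lemma validP_modify l : validP l -> validP (modify l).
Proof.
move=> vl f fm; have /vl [Pf pf] := fsubsetP (finsupp_modify l) f fm.
by split=> //; rewrite modifyE; case: ifP => // _; apply: modpart_partition.
Qed.

Lemma norm_modify l : validP l -> norm l = (norm (modify l) + lenE l)%N.
Proof.
pose G f s := ((size f).-1 * sumn s)%N.
move=> vl; rewrite /norm (sum_finsupp (G := G) _ (finsupp_modify l)); last first.
  by move=> f; rewrite /G muln0.
rewrite /G.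
have [X1l|nX1] := boolP (X1 \in finsupp l); last first.
  rewrite /lenE /eigpart fsfun_dflt // addn0; apply: eq_big_seq => f fl.
  by rewrite modifyE ifF //; apply: contraNF nX1 => /eqP <-.
rewrite !(bigD1_seq X1) ?fset_uniq //= modifyE eqxx size_Xsub1 !mul1n.
rewrite sumn_modpart ?validP_partition // -addnA [(size _ + _)%N]addnC addnA.
congr (_ + _ + _)%N; apply: eq_bigr => f nf.
by rewrite modifyE (negPf nf).
Qed.

Lemma isType_norm n (g : 'M[F]_n) l : isType g l -> n = norm l.
Proof.
case=> _ /sim_dim ->; rewrite bdiag_dim sum_blocks; apply: eq_bigr => f _.
by rewrite sumnE big_distrr /=; apply: eq_bigr => k _; rewrite size_exp.
Qed.

Lemma irreducible_coprime f h : f \is monic -> h \is monic ->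
  irreducible_poly f -> irreducible_poly h -> f != h -> coprimep f h.
Proof.
move=> mf mh irrf irrh nfh; rewrite irreducible_poly_coprime //.
apply: contra nfh => fh; rewrite -eqp_monic //; apply: irrh.2 fh.
by rewrite neq_ltn irrf.1 orbT.
Qed.

(** Blocks at other polynomials are coprime to [f] and contribute nothing; the blocks at [f] are
    given by [nul_primary]. *)
Lemma nul_isType n (g : 'M[F]_n) l f j : isType g l -> inPhi f ->
  nul (f ^+ j) g = ((size f).-1 * \sum_(k <- l f) minn j k)%N.
Proof.
case=> vl sg [mf [irrf _]]; rewrite (sim_nul _ sg) nul_bdiag.
rewrite (sum_blocks l (fun b => nul (f ^+ j) (companionmx b))).
have nul0 h : h \in finsupp l -> h != f ->
    (\sum_(k <- l h) nul (f ^+ j) (companionmx (h ^+ k)) = 0)%N.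
  move=> /vl [[mh [irrh _]] _] nhf; rewrite big1 // => k _.
  apply: (@nul_coprime _ _ _ _ (h ^+ k)); last by rewrite phorner_companion ?monic_exp.
  by rewrite coprimep_expl // coprimep_expr // irreducible_coprime // eq_sym.
have nulf : (\sum_(k <- l f) nul (f ^+ j) (companionmx (f ^+ k)) =
    (size f).-1 * \sum_(k <- l f) minn j k)%N.
  by rewrite big_distrr /=; apply: eq_bigr => k _; rewrite nul_primary.
have [fl|nf] := boolP (f \in finsupp l).
  rewrite (bigD1_seq f) ?fset_uniq //= nulf [X in (_ + X)%N]big_seq_cond.
  rewrite [X in (_ + X)%N]big1 ?addn0 // => h /andP [].
  exact: nul0.
rewrite fsfun_dflt // big_nil muln0 big_seq big1 // => h hl; apply: nul0 => //.
by apply: contraNneq nf => <-.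
Qed.

Lemma nul_isType_succ n (g : 'M[F]_n) l f j : isType g l -> inPhi f ->
  (nul (f ^+ j.+1) g = nul (f ^+ j) g + (size f).-1 * count (ltn j) (l f))%N.
Proof.
move=> tg Pf; rewrite !(nul_isType _ tg Pf) -mulnDr; congr (_ * _)%N.
elim: (l f) => [|k s IH]; first by rewrite !big_nil.
rewrite !big_cons /= IH addnACA; congr (_ + _)%N.
have minnS (a b : nat) : minn a.+1 b = (minn a b + (a < b))%N by lia.
exact: minnS.
Qed.

(** The count is the increment of nullity from [f^j] to [f^(j+1)], divided by the degree of [f].
    Equality of increments is stated as an identity of sums to avoid truncated subtraction. *)
Lemma isType_count m n (g : 'M[F]_m) (h : 'M[F]_n) l l' f j :
  isType g l -> isType h l' -> inPhi f ->
  (nul (f ^+ j.+1) g + nul (f ^+ j) h = nul (f ^+ j.+1) h + nul (f ^+ j) g)%N ->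
  count (ltn j) (l f) = count (ltn j) (l' f).
Proof.
move=> tg th Pf; rewrite (nul_isType_succ _ tg Pf) (nul_isType_succ _ th Pf).
have d_gt0 : (0 < (size f).-1)%N.
  by case: Pf => _ [[sf _] _]; rewrite -ltnS prednK // ltnW.
move=> e; apply/eqP; rewrite -(eqn_pmul2l d_gt0); apply/eqP; lia.
Qed.

Lemma lenE_isType n (g : 'M[F]_n) l : isType g l -> lenE l = nul X1 g.
Proof.
move=> tg; have := nul_isType_succ 0 tg (inPhi_Xsub1 F).
rewrite expr1 expr0 nul1 size_Xsub1 mul1n add0n => ->.
by rewrite count_gt0 // validP_partition //; case: tg.
Qed.

(** The full type has norm [n]; modification removes the length of the partition at [t - 1], which
    is the nullity of [g - 1]. *)
Lemma norm_modType n (g : 'M[F]_n) : g \in unitmx ->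
  norm (modType g) = \rank (g - 1%:M).
Proof.
move/typeOfP => tg; have := isType_norm tg; have vl := tg.1.
rewrite (norm_modify vl) (lenE_isType tg) /nul phornerXsub1 /modType.
have aux (a b c : nat) : (b <= c -> c = a + (c - b) -> a = b)%N by lia.
exact: aux (rank_leq_row _).
Qed.

Lemma norm_lenE n (g : 'M[F]_n) : g \in unitmx ->
  n = (norm (modType g) + lenE (typeOf g))%N.
Proof. by move/typeOfP => tg; rewrite /modType -norm_modify ?tg.1 -?(isType_norm tg); case: tg. Qed.

Lemma validP_modType n (g : 'M[F]_n) : g \in unitmx -> validP (modType g).
Proof. by move/typeOfP => [vl _]; apply: validP_modify. Qed.

(** The only lost datum is the length of the partition at [t - 1], and [norm_lenE] recovers it from
    the common size [n]. The full types then agree. *)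
Lemma modType_sim n (g h : 'M[F]_n) : g \in unitmx -> h \in unitmx ->
  modType g = modType h -> sim g h.
Proof.
move=> ug uh e; have [vg sg] := typeOfP ug; have [vh sh] := typeOfP uh.
suff el : typeOf g = typeOf h.
  by apply: sim_trans sg _; rewrite el; apply: sim_sym.
have elen : lenE (typeOf g) = lenE (typeOf h).
  by apply: (@addnI (norm (modType g))); rewrite -norm_lenE // e -norm_lenE.
apply/fsfunP => f; have := congr1 (fun l : Raw F => l f) e.
rewrite /= /modType !modifyE; case: eqP => // -> em.
apply: partition_eq; rewrite ?validP_partition // => -[|j].
  by rewrite !count_gt0 ?validP_partition.
by rewrite -!count_modpart em.
Qed.

(** * Adjoining and removing identity blocks *)

Lemma phorner_scalar1 n (p : {poly F}) : phorner (1%:M : 'M[F]_n) p = p.[1]%:M.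
Proof.
elim/poly_ind: p => [|p c IH]; first by rewrite phorner0 horner0 raddf0.
by rewrite phornerD phorner_mulX mul1mx phornerC IH hornerMXaddC mulr1 raddfD.
Qed.

Lemma nul_scalar1 n (p : {poly F}) :
  nul p (1%:M : 'M[F]_n) = if p.[1] == 0 then n else 0%N.
Proof.
rewrite /nul phorner_scalar1; case: eqP => [->|/eqP nz]; first by rewrite raddf0 mxrank0 subn0.
by rewrite mxrank_unit ?subnn // unitmxE det_scalar unitrX ?unitfE.
Qed.

Lemma unitmx_block1 m n (g : 'M[F]_m) :
  (block_mx g 0 0 (1%:M : 'M_n) \in unitmx) = (g \in unitmx).
Proof. by rewrite !unitmxE det_ublock det1 mulr1. Qed.

(** The identity block adds only parts 1 at [t - 1], which modification discards. Any other [f] in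
    Phi has [f(1) != 0], so its nullities do not change. *)
Lemma modType_block1 m n (g : 'M[F]_m) : g \in unitmx ->
  modType (block_mx g 0 0 (1%:M : 'M_n)) = modType g.
Proof.
move=> ug; set h := block_mx _ _ _ _; have uh : h \in unitmx by rewrite unitmx_block1.
have [tg th] := (typeOfP ug, typeOfP uh); have [vg vh] := (tg.1, th.1).
(* At [f = t - 1] the count for [j = 0] grows by the size of the identity block. It is left out, as
   the modified partition sees only the counts from [j = 1] on. *)
have ec f j : inPhi f -> (f == X1) ==> (0 < j)%N ->
    count (ltn j) (typeOf h f) = count (ltn j) (typeOf g f).
  move=> Pf fj; apply: (isType_count th tg Pf); rewrite !nul_block !nul_scalar1 !horner_exp.
  have [fX|nfX] := eqVneq f X1.
    move: fj; rewrite fX eqxx => /=; case: j => // j _.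
    by rewrite hornerD hornerN hornerX hornerC subrr !expr0n /= eqxx addnAC addnA.
  have f1 : f.[1] != 0.
    apply: contraNneq nfX => /eqP; rewrite -[_ == 0]/(root f 1) root_factor_theorem polyC1.
    case: Pf => mf [irrf _] df; rewrite eq_sym -eqp_monic ?monic_Xsub1 //.
    by apply: irrf.2 df; rewrite size_Xsub1.
  by rewrite !expf_eq0 (negPf f1) !andbF !addn0.
apply/fsfunP => f; rewrite /modType !modifyE; case: (classic (inPhi f)) => [Pf|nPf]; last first.
  by rewrite !(validP_notin (f := f)).
case: eqP => [fX|/eqP nfX]; apply: partition_eq;
  rewrite ?modpart_partition ?validP_partition // => j.
  by rewrite !count_modpart ec // implybT.
by rewrite ec // (negPf nfX).
Qed.

(** Splitting off every block [t - 1], that is, every part 1 at [t - 1], leaves an element of the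
    least size at which this modified type occurs. It is the size at which [astab] evaluates the
    coefficient. *)
Lemma modType_core n (g : 'M[F]_n) : g \in unitmx ->
  exists m c (g0 : 'M[F]_m), [/\ m = (norm (modType g) + lenE (modType g))%N,
    n = (m + c)%N, g0 \in unitmx, modType g0 = modType g &
    sim g (block_mx g0 0 0 (1%:M : 'M_c))].
Proof.
move=> ug; have tg := typeOfP ug; have [vg sg] := tg.
set bs := blocks (typeOf g) in sg.
pose c := count_mem X1 bs; pose s' := [seq b <- bs | b != X1].
have bsE : perm_eq bs (s' ++ nseq c X1).
  rewrite perm_sym (perm_trans _ (permEl (perm_filterC (predC1 X1) bs))) //.
  rewrite perm_cat2l /c -size_filter.
  suff -> : [seq b <- bs | predC (predC1 X1) b] = nseq (count_mem X1 bs) X1.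
    by rewrite size_filter.
  have e : [seq b <- bs | predC (predC1 X1) b] = [seq b <- bs | pred1 X1 b].
    by apply: eq_filter => b /=; rewrite negbK.
  rewrite e -size_filter; apply/all_pred1P; exact: filter_all.
set g0 := bdmx s'.
have sg' : sim g (block_mx g0 0 0 (bdmx (nseq c X1))).
  apply: sim_trans sg _; apply: sim_trans (sim_bdiag_perm bsE) _; exact: sim_bdiag_cat.
have cE : projT1 (bdiag (nseq c X1)) = c.
  by rewrite bdiag_dim big_nseq size_Xsub1 /= iter_addn addn0 mul1n.
rewrite bdiag_nseq in sg'; rewrite cE in sg'.
have ug0 : g0 \in unitmx.
  rewrite -(unitmx_block1 c) unitmx_nul -(sim_nul _ sg') -unitmx_nul //.
have e0 : modType g0 = modType g by rewrite -(modType_block1 c ug0) /modType (sim_typeOf sg').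
exists _, c, g0; split=> //; last exact: sim_dim sg'.
have d0 := norm_lenE ug0; have d := norm_lenE ug; have dd := sim_dim sg'.
have vg0 := (typeOfP ug0).1.
(* This bounds [m] from below. The next inequality bounds it from above: each part 1 at [t - 1]
   accounts for one of the [c] blocks removed. *)
have size_le : (lenE (modType g) <= lenE (typeOf g0))%N.
  rewrite -e0 /lenE /eigpart /modType modifyE eqxx size_modpart ?validP_partition //.
  exact: count_size.
have c_ge : (lenE (typeOf g) <= c + lenE (modType g))%N.
  rewrite /lenE /eigpart /modType modifyE eqxx size_modpart ?validP_partition //.
  set p := typeOf g X1; have pp : is_partition p by apply: validP_partition.
  apply: (@leq_trans (count_mem 1%N p + count (ltn 1) p)).
    by rewrite (count_mem_partition 1 pp) -count_gt0 // subnK // sub_count // => -[|[]].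
  have -> : c = (\sum_(b <- blocks (typeOf g)) if pred1 X1 b then 1 else 0)%N.
    by rewrite /c -sum1_count big_mkcond.
  rewrite leq_add2r (sum_blocks _ (fun b => if pred1 X1 b then 1 else 0)%N).
  have [Xl|nX] := boolP (X1 \in finsupp (typeOf g)); last by rewrite /p fsfun_dflt.
  rewrite (bigD1_seq X1) ?fset_uniq //= -/p (leq_trans _ (leq_addr _ _)) //.
  rewrite -sum1_count big_mkcond; apply: leq_sum => k _ /=.
  by case: eqP => // ->; rewrite expr1 eqxx.
rewrite e0 in d0; lia.
Qed.

Lemma lenE_le_norm nu : validP nu -> (lenE nu <= norm nu)%N.
Proof.
move=> vn; rewrite /norm /lenE /eigpart.
have [Xn|nX] := boolP (X1 \in finsupp nu); last by rewrite fsfun_dflt.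
rewrite (bigD1_seq X1) ?fset_uniq //= size_Xsub1 mul1n (leq_trans _ (leq_addr _ _)) //.
by rewrite (sumn_modpart (validP_partition _ vn)) leq_addl.
Qed.

End ModifiedType.

(** * Structure constants *)

Section Factorisation.
Variable F : fieldType.

Lemma rank_mul_sub1 n (h k : 'M[F]_n) :
  (\rank (h *m k - 1%:M)%R <= \rank (h - 1%:M)%R + \rank (k - 1%:M)%R)%N.
Proof.
have -> : h *m k - 1%:M = (h - 1%:M) *m k + (k - 1%:M).
  by rewrite mulmxBl mul1mx addrA subrK.
by apply: leq_trans (mxrank_add _ _) _; rewrite leq_add2r mxrankM_maxl.
Qed.

Lemma fixed_sub1 m n (x : 'M[F]_(m, n)) (g : 'M[F]_n) :
  (x <= kermx (g - 1%:M))%MS = (x *m g == x).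
Proof. by rewrite (sameP sub_kermxP eqP) mulmxBr mulmx1 subr_eq0. Qed.

(* [ker (h - 1) :&: ker (k - 1)] is contained in [ker (h k - 1)], and has at least
   its dimension when the ranks add up. *)
Lemma fixed_factors m n (x : 'M[F]_(m, n)) (h k : 'M[F]_n) :
  (\rank (h - 1%:M)%R + \rank (k - 1%:M)%R = \rank (h *m k - 1%:M)%R)%N ->
  x *m (h *m k) = x -> x *m h = x /\ x *m k = x.
Proof.
set H := kermx (h - 1%:M); set K := kermx (k - 1%:M).
set G := kermx (h *m k - 1%:M) => rk xg.
have HKG : (H :&: K <= G)%MS.
  apply/rV_subP => v; rewrite sub_capmx !fixed_sub1 => /andP [/eqP vh /eqP vk].
  by rewrite mulmxA vh vk.
have GHK : (G <= H :&: K)%MS.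
  rewrite -(mxrank_leqif_sup HKG) eqn_leq mxrankS //.
  have aux (a b c d s n' : nat) : (a + b = c -> a <= n' -> b <= n' -> s <= n' ->
    s + d = (n' - a) + (n' - b) -> n' - c <= d)%N by lia.
  rewrite [\rank G]mxrank_ker.
  apply: aux rk _ _ (rank_leq_col (H + K)%MS) _; try exact: rank_leq_row.
  by rewrite mxrank_sum_cap !mxrank_ker.
have : (x <= H :&: K)%MS by apply: submx_trans GHK; rewrite fixed_sub1 xg.
by rewrite sub_capmx !fixed_sub1 => /andP [/eqP ? /eqP ?].
Qed.

(** The last [c] basis row vectors are fixed by [h k], hence by [h], which determines the lower
    blocks of [h]. The same argument for [k^T h^T], whose ranks are unchanged, makes the upper right
    block zero. *)
Lemma factor_block1 m c (g : 'M[F]_m) (h k : 'M[F]_(m + c)) :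
  h *m k = block_mx g 0 0 1%:M ->
  (\rank (h - 1%:M)%R + \rank (k - 1%:M)%R = \rank (h *m k - 1%:M)%R)%N ->
  h = block_mx (ulsubmx h) 0 0 1%:M.
Proof.
move=> hk rk.
have [|rowh _] := @fixed_factors _ _ (row_mx 0 1%:M : 'M_(c, m + c)) h k rk.
  by rewrite hk mul_row_block !mul0mx !mulmx0 mul1mx addr0 add0r.
have rk' : (\rank (k^T - 1%:M)%R + \rank (h^T - 1%:M)%R = \rank (k^T *m h^T - 1%:M)%R)%N.
  by rewrite -trmx_mul -(trmx1 F) -!linearB /= !mxrank_tr addnC.
have [|_ colh] := @fixed_factors _ _ (row_mx 0 1%:M : 'M_(c, m + c)) _ _ rk'.
  rewrite -trmx_mul hk tr_block_mx !trmx0 trmx1.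
  by rewrite mul_row_block !mul0mx !mulmx0 mul1mx addr0 add0r.
move: rowh colh; rewrite -{1 2}[h]submxK tr_block_mx !mul_row_block !mul0mx !mul1mx !add0r.
move=> /eq_row_mx [hdl hdr] /eq_row_mx [hur _].
by rewrite -[LHS]submxK hdl hdr -[ursubmx h]trmxK hur trmx0.
Qed.

End Factorisation.

(** * Class functions, the filtration and stability of the coefficients *)

Section GroupRing.
Variable F : finFieldType.
Implicit Types l mu nu : Raw F.

Lemma mulZGE n (x y : ZG F n) g : g \in unitmx ->
  mulZG x y g = \sum_(h | h \in unitmx) x h * y (invmx h *m g).
Proof.
move=> ug; rewrite ffunE; apply: eq_bigr => h uh.
rewrite (big_pred1 (invmx h *m g)) // => k /=.
apply/andP/eqP => [[uk /eqP <-]|->]; first by rewrite mulKmx.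
by rewrite mulKVmx // unitmx_mul unitmx_inv uh ug.
Qed.

Lemma mulZG_nonunit n (x y : ZG F n) g : g \notin unitmx -> mulZG x y g = 0.
Proof.
move=> ug; rewrite ffunE big1 // => h uh; rewrite big1 // => k /andP [uk /eqP e].
by case/negP: ug; rewrite -e unitmx_mul uh uk.
Qed.

Definition classfun n (x : ZG F n) : Prop :=
  (forall g, g \notin unitmx -> x g = 0) /\
  (forall g h, g \in unitmx -> h \in unitmx -> modType g = modType h -> x g = x h).

Lemma classfun0 n : classfun (0 : ZG F n).
Proof. by split=> *; rewrite !ffunE. Qed.

Lemma classfunD n (x y : ZG F n) : classfun x -> classfun y -> classfun (x + y).
Proof.
move=> [x0 cx] [y0 cy]; split=> [g ug|g h ug uh e]; rewrite !ffunE.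
  by rewrite x0 // y0 // addr0.
by rewrite (cx g h) // (cy g h).
Qed.

Lemma classfunN n (x : ZG F n) : classfun x -> classfun (- x).
Proof.
move=> [x0 cx]; split=> [g ug|g h ug uh e]; rewrite !ffunE.
  by rewrite x0 // oppr0.
by rewrite (cx g h).
Qed.

Lemma classfun_sum n (I : Type) (r : seq I) (P : pred I) (x : I -> ZG F n) :
  (forall i, P i -> classfun (x i)) -> classfun (\sum_(i <- r | P i) x i).
Proof.
move=> cx; elim/big_ind: _ => //; first exact: classfun0.
by move=> *; apply: classfunD.
Qed.

Lemma ZG_mulz n (x : ZG F n) (c : int) g : (x *~ c) g = c * x g.
Proof. by rewrite ffunMzE -mulrzl intz. Qed.

Lemma ZG_sub n (x y : ZG F n) g : (x - y) g = x g - y g.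
Proof. by rewrite !ffunE. Qed.

Lemma classfunMz n (x : ZG F n) (c : int) : classfun x -> classfun (x *~ c).
Proof.
move=> [x0 cx]; split=> [g ug|g h ug uh e]; rewrite !ZG_mulz.
  by rewrite x0 // mulr0.
by rewrite (cx g h).
Qed.

Lemma classfun_Kc n l : classfun (Kc n l).
Proof.
split=> [g /negPf ug|g h ug uh e]; rewrite !ffunE ?ug //.
by rewrite uh e.
Qed.

(** Equal modified types give an invertible [P] with [g P = P h]. Conjugation by [P] carries the
    factorisations of [h] to those of [g] and preserves the modified types of the factors. *)
Lemma classfun_mul n (x y : ZG F n) : classfun x -> classfun y -> classfun (mulZG x y).
Proof.
move=> [_ cx] [_ cy]; split=> [g|g h ug uh /(modType_sim ug uh)]; first exact: mulZG_nonunit.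
case=> P [/andP [fP _] gP]; have uP : P \in unitmx by rewrite -row_free_unit.
have conj (a : 'M[F]_n) : modType (P *m a *m invmx P) = modType a.
  rewrite /modType (@sim_typeOf _ _ _ _ a) //; exists P; split.
    by rewrite fP row_full_unit.
  by rewrite mulmxKV.
have inj : injective (fun a : 'M[F]_n => P *m a *m invmx P).
  by move=> a b /(congr1 (mulmx (invmx P) \o mulmx^~ P)) /=; rewrite !mulmxKV // !mulKmx.
rewrite !mulZGE // (reindex_inj inj) /=.
have uconj (a : 'M[F]_n) : (P *m a *m invmx P \in unitmx) = (a \in unitmx).
  by rewrite !unitmx_mul unitmx_inv uP andbT.
apply: eq_big => [a|a]; rewrite uconj // => ua; congr (_ * _).
  by apply: cx; rewrite ?uconj.
apply: cy; rewrite ?[_ *m _ \in _]unitmx_mul ?unitmx_inv ?uconj ?ua ?ug ?uh //.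
rewrite -[RHS]conj; congr modType.
have gE : g = P *m h *m invmx P by rewrite -gP mulmxK.
have ua' : P *m a *m invmx P \in unitmx by rewrite uconj.
apply: (can_inj (mulKmx ua')); rewrite mulKVmx // gE !mulmxA mulmxKV //.
by rewrite mulmxK.
Qed.

Lemma Kc_unit n l g : g \in unitmx -> Kc n l g = (modType g == l)%:R.
Proof. by move=> ug; rewrite ffunE ug; case: eqP. Qed.

Lemma mem_cls n (g : 'M[F]_n) : g \in unitmx -> modType g \in cls F n.
Proof. by move=> ug; rewrite mem_undup map_f // mem_filter ug mem_enum. Qed.

Lemma clsP n nu : nu \in cls F n -> exists2 g : 'M[F]_n, g \in unitmx & modType g = nu.
Proof. by rewrite mem_undup => /mapP [g]; rewrite mem_filter => /andP [ug _] ->; exists g. Qed.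

Lemma sum_Kc n (s : seq (Raw F)) (P : pred (Raw F)) (c : Raw F -> int) g :
  uniq s -> g \in unitmx ->
  (\sum_(r <- s | P r) Kc n r *~ c r) g =
  if (modType g \in s) && P (modType g) then c (modType g) else 0.
Proof.
move=> us ug; rewrite sum_ffunE big_mkcond.
have cE r : (if P r then (Kc n r *~ c r) g else 0) =
    if (r == modType g) && P r then c r else 0.
  rewrite ZG_mulz Kc_unit // eq_sym; case: (r == _) (P r) => -[] //=.
    by rewrite mulr1.
  by rewrite mulr0.
rewrite (eq_bigr _ (fun r _ => cE r)); have [ms|ns] := boolP (modType g \in s).
  rewrite (bigD1_seq (modType g)) //= eqxx big1 ?addr0 // => r /negPf -> //.
rewrite big_seq big1 // => r rs; case: eqP => // e.
by rewrite -e rs in ns.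
Qed.

(** The coefficient of [K_r(n)] is the value at any element of modified type [r]. With the converse
    [inKlt_classfunP], congruences in the graded ring become pointwise vanishing. *)
Lemma inKlt_classfun n m (x : ZG F n) : classfun x ->
  (forall g, g \in unitmx -> (m <= norm (modType g))%N -> x g = 0) -> inKlt m x.
Proof.
move=> cx x0; exists (cls F n).
exists (fun r => if [pick g : 'M[F]_n | (g \in unitmx) && (modType g == r)] is Some g
  then x g else 0); split=> [r /clsP [g ug <-]|]; first exact: validP_modType.
apply/ffunP => g; have [ug|nug] := boolP (g \in unitmx); last first.
  rewrite cx.1 //; apply/esym; apply: (classfun_sum _ _).1 => // r _.
  exact: classfunMz (classfun_Kc n r).
rewrite sum_Kc ?undup_uniq // mem_cls //=; case: ltnP => nm; last exact: x0.
case: pickP => [h /andP [uh /eqP e]|/(_ g)]; last by rewrite ug eqxx.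
by apply: cx.2.
Qed.

Lemma inKlt_classfunP n m (x : ZG F n) : inKlt m x -> classfun x /\
  (forall g, g \in unitmx -> (m <= norm (modType g))%N -> x g = 0).
Proof.
case=> s [c [_ ->]]; split=> [|g ug mg].
  by apply: classfun_sum => r _; apply: classfunMz; apply: classfun_Kc.
rewrite sum_ffunE big1 // => r rm; rewrite ZG_mulz Kc_unit //.
by case: eqP => [e|_]; rewrite ?mulr0 //; move: mg; rewrite e leqNgt rm.
Qed.

(** A nonzero term would factor [g] as [h k] with [h - 1] and [k - 1] of ranks [norm l] and
    [norm mu], against subadditivity. *)
Lemma mulKc_gt n l mu (g : 'M[F]_n) : g \in unitmx ->
  (norm l + norm mu < norm (modType g))%N -> mulZG (Kc n l) (Kc n mu) g = 0.
Proof.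
move=> ug; rewrite norm_modType // ltnNge => lt_g; rewrite mulZGE // big1 // => h uh.
have uk : invmx h *m g \in unitmx by rewrite unitmx_mul unitmx_inv uh.
rewrite !Kc_unit //; case: eqP => [eh|]; rewrite ?mul0r //.
case: eqP => [ek|]; rewrite ?mulr0 //; case/negP: lt_g.
by rewrite -eh -ek !norm_modType // -{1}(mulKVmx uh g) rank_mul_sub1.
Qed.

(* Every factorisation of [diag(g, 1)] contributing to the coefficient is of the
   form [diag(h, 1) diag(k, 1)], by [factor_block1]. *)
Lemma mulKc_block1 m c l mu (g : 'M[F]_m) : g \in unitmx ->
  (norm l + norm mu)%N = norm (modType g) ->
  mulZG (Kc (m + c) l) (Kc (m + c) mu) (block_mx g 0 0 1%:M) = mulZG (Kc m l) (Kc m mu) g.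
Proof.
move=> ug nE; set G := block_mx _ _ _ _; have uG : G \in unitmx by rewrite unitmx_block1.
pose diag1 (h : 'M[F]_m) : 'M_(m + c) := block_mx h 0 0 1%:M.
rewrite !mulZGE // (bigID (fun h => diag1 (ulsubmx h) == h)) /= addrC big1 ?add0r; last first.
  move=> h /andP [uh /eqP nh]; have uk : invmx h *m G \in unitmx.
    by rewrite unitmx_mul unitmx_inv uh.
  rewrite !Kc_unit //; case: eqP => [eh|]; rewrite ?mul0r //.
  case: eqP => [ek|]; rewrite ?mulr0 //; case: nh; apply/esym.
  apply: (@factor_block1 _ _ _ g _ (invmx h *m G)); rewrite mulKVmx //.
  by rewrite -!norm_modType // eh ek nE modType_block1.
rewrite (reindex_onto diag1 ulsubmx) /= => [|h /andP [_ /eqP //]].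
apply: eq_big => [h|h /andP [/andP [uh _] _]].
  by rewrite /diag1 block_mxKul !eqxx !andbT unitmx_block1.
rewrite unitmx_block1 in uh.
have -> : invmx (diag1 h) *m G = diag1 (invmx h *m g).
  apply: (can_inj (mulKmx (_ : diag1 h \in unitmx))); rewrite ?unitmx_block1 //.
  rewrite mulKVmx ?unitmx_block1 // mulmx_block !mul0mx !mulmx0 !addr0 !add0r mulKVmx //.
  by rewrite mulmx1.
have uk : invmx h *m g \in unitmx by rewrite unitmx_mul unitmx_inv uh.
by rewrite !Kc_unit ?unitmx_block1 // !modType_block1.
Qed.

(** The product is a class function, so [g] may be replaced by its core extended by an identity
    block, and [mulKc_block1] drops that block. The core has exactly the size used in [astab]. *)
Lemma astabE n l mu nu (g : 'M[F]_n) : g \in unitmx -> modType g = nu ->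
  (norm l + norm mu)%N = norm nu -> mulZG (Kc n l) (Kc n mu) g = astab l mu nu.
Proof.
move=> ug gnu nE; have [m [c [g0 [mE nmc ug0]]]] := modType_core ug.
rewrite gnu in mE *; subst n => g0nu sg.
have [_ cf] := classfun_mul (classfun_Kc (m + c) l) (classfun_Kc (m + c) mu).
rewrite (cf g (block_mx g0 0 0 1%:M)) ?unitmx_block1 ?modType_block1 ?g0nu //.
rewrite mulKc_block1 ?g0nu // /astab /acoef -mE.
case: pickP => [h /andP [uh /eqP hnu]|/(_ g0)]; last by rewrite ug0 g0nu eqxx.
by apply: (classfun_mul (classfun_Kc m l) (classfun_Kc m mu)).2; rewrite ?hnu.
Qed.

(** This justifies the size [2 * m] in [ofNorm]: the core has size [norm nu + lenE nu], at most
    twice the norm, and an identity block fills up the rest. *)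
Lemma mem_ofNorm n (g : 'M[F]_n) : g \in unitmx -> modType g \in ofNorm F (norm (modType g)).
Proof.
move=> ug; rewrite mem_filter eqxx /=.
have vnu := validP_modType ug; set nu := modType g in vnu *.
have [m [c [g0 [mE _ ug0 g0nu _]]]] := modType_core ug; rewrite -/nu in mE g0nu.
have le_m : (m <= 2 * norm nu)%N by rewrite mE mul2n -addnn leq_add2l lenE_le_norm.
move: le_m; move: (2 * norm nu)%N => N le_m.
rewrite -(subnKC le_m) -g0nu -(modType_block1 (N - m) ug0).
by rewrite mem_cls // unitmx_block1.
Qed.

(** * Pointwise values of [phi] and of the two products *)

Lemma phiE n (x : GQ F) i (g : 'M[F]_n) : g \in unitmx ->
  phi n x i g = if norm (modType g) == i then x (modType g) else 0.
Proof.
move=> ug; rewrite /phi sum_Kc ?fset_uniq //.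
have [|nx] := boolP (modType g \in finsupp x) => //=.
by rewrite fsfun_dflt ?if_same.
Qed.

Lemma classfun_phi n (x : GQ F) i : classfun (phi n x i).
Proof. by apply: classfun_sum => r _; apply: classfunMz; apply: classfun_Kc. Qed.

Lemma eq_classfun n (x y : ZG F n) : classfun x -> classfun y ->
  (forall g, g \in unitmx -> x g = y g) -> x = y.
Proof.
move=> [x0 _] [y0 _] e; apply/ffunP => g; have [/e //|ng] := boolP (g \in unitmx).
by rewrite x0 // y0.
Qed.

Lemma eq_GEeq n (X Y : GE F n) : (forall i, X i = Y i) -> GEeq X Y.
Proof.
move=> e i; rewrite e subrr; apply: inKlt_classfun; first exact: classfun0.
by move=> g _ _; rewrite ffunE.
Qed.

Lemma classfun_GEmul n (X Y : GE F n) i :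
  (forall j, classfun (X j)) -> (forall j, classfun (Y j)) -> classfun (GEmul X Y i).
Proof. by move=> cX cY; apply: classfun_sum => j _; apply: classfun_mul. Qed.

Lemma mulZG_sum n (I J : Type) (r : seq I) (s : seq J) (P : pred I) (Q : pred J)
    (x : I -> ZG F n) (y : J -> ZG F n) (a : I -> int) (b : J -> int) g : g \in unitmx ->
  mulZG (\sum_(i <- r | P i) x i *~ a i) (\sum_(j <- s | Q j) y j *~ b j) g =
  \sum_(i <- r | P i) \sum_(j <- s | Q j) a i * b j * mulZG (x i) (y j) g.
Proof.
move=> ug; rewrite mulZGE //.
under eq_bigr => h _ do rewrite !sum_ffunE big_distrl /=.
rewrite exchange_big /=; apply: eq_bigr => i _.
under eq_bigr => h _ do rewrite big_distrr /=.
rewrite exchange_big /=; apply: eq_bigr => j _.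
rewrite mulZGE // big_distrr /=; apply: eq_bigr => h _.
by rewrite !ZG_mulz mulrACA.
Qed.

(** A pair [(l, mu)] meets the convolution only at the index [j = norm l], where the complementary
    index [i - j] must be [norm mu]. *)
Lemma GEmul_phi n (x y : GQ F) i (g : 'M[F]_n) : g \in unitmx ->
  GEmul (phi n x) (phi n y) i g =
  \sum_(l <- finsupp x) \sum_(mu <- finsupp y)
    if (norm l + norm mu)%N == i then x l * y mu * mulZG (Kc n l) (Kc n mu) g else 0.
Proof.
move=> ug; rewrite /GEmul sum_ffunE.
under eq_bigr => j _ do rewrite mulZG_sum // big_mkcond.
rewrite exchange_big /=; apply: eq_bigr => l _.
have [le_li|lt_il] := leqP (norm l) i; last first.
  rewrite big1 => [|j _]; last by rewrite ifF // gtn_eqF // (leq_trans _ lt_il).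
  apply/esym/big1 => mu _; rewrite ifF // gtn_eqF //.
  exact: leq_trans lt_il (leq_addr _ _).
rewrite (bigD1 (Ordinal (le_li : norm l < i.+1)%N)) //= eqxx [X in _ + X]big1 ?addr0.
  by rewrite big_mkcond; apply: eq_bigr => mu _; rewrite -(eqn_add2l (norm l)) subnKC.
move=> j nj; rewrite ifF //; apply: contraNF nj => /eqP e.
by apply/eqP/val_inj.
Qed.

(** The finite support imposed in [GQmul] loses no coefficient: by [mem_ofNorm] every modified type
    of the relevant norm is listed. *)
Lemma GQmulE (x y : GQ F) n (g : 'M[F]_n) : g \in unitmx ->
  GQmul x y (modType g) = \sum_(l <- finsupp x) \sum_(mu <- finsupp y)
    x l * y mu * (if norm (modType g) == (norm l + norm mu)%N
                  then astab l mu (modType g) else 0).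
Proof.
move=> ug; rewrite /GQmul fsfun_fun seq_fsetE; case: ifP => // /negP nm.
apply/esym; rewrite big_seq big1 // => l lx; rewrite big_seq big1 // => mu my.
case: eqP => [e|_]; last by rewrite mulr0.
case: nm; apply/flattenP; exists (ofNorm F (norm l + norm mu)); last by rewrite -e mem_ofNorm.
by apply/allpairsP; exists (l, mu).
Qed.

Lemma norm_eq0 nu : validP nu -> norm nu = 0%N -> nu = emptyRaw F.
Proof.
move=> vn /eqP; rewrite sum_nat_seq_eq0 => /allP n0; apply/fsfunP => f.
rewrite [RHS]fsfun_fun inE; have [fn|nf] := boolP (f \in finsupp nu); last exact: fsfun_dflt.
have [[_ [[sf _] _]] /andP [_ pf]] := vn f fn.
have := n0 f fn; rewrite muln_eq0 /= => /orP [|].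
  by move: sf; case: (size f) => // -[].
by case: (nu f) pf => //= k s /andP [k0 _]; rewrite addn_eq0 eqn0Ngt k0.
Qed.

Lemma norm_emptyRaw : norm (emptyRaw F) = 0%N.
Proof.
rewrite /norm big1_seq // => f /andP [_ fe]; move: fe.
by rewrite mem_finsupp fsfun_fun inE eqxx.
Qed.

(** Both conditions say that [g - 1] has rank 0. Consequently the unit of the group ring is the
    class sum of the empty type. *)
Lemma modType_eq_empty n (g : 'M[F]_n) : g \in unitmx ->
  (modType g == emptyRaw F) = (g == 1%:M).
Proof.
move=> ug; apply/eqP/eqP => [e|e].
  apply/eqP; rewrite -subr_eq0 -mxrank_eq0 -norm_modType // e norm_emptyRaw //.
apply: norm_eq0; first exact: validP_modType.
by rewrite norm_modType // e subrr mxrank0.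
Qed.

Lemma classfun_oneZG n : classfun (oneZG F n).
Proof.
have e : oneZG F n = Kc n (emptyRaw F).
  apply/ffunP => g; rewrite !ffunE; have [ug|nug] /= := boolP (g \in unitmx).
    by rewrite modType_eq_empty.
  by case: eqP nug => // ->; rewrite unitmx1.
by rewrite e; apply: classfun_Kc.
Qed.

Lemma GEmul_emb n l mu i : GEmul (GEemb n l) (GEemb n mu) i =
  if i == (norm l + norm mu)%N then mulZG (Kc n l) (Kc n mu) else 0.
Proof.
have mul0 (x y : ZG F n) : x = 0 \/ y = 0 -> mulZG x y = 0.
  move=> e; apply/ffunP => g; rewrite !ffunE big1 // => h _; rewrite big1 // => k _.
  by case: e => ->; rewrite ffunE ?mul0r ?mulr0.
rewrite /GEmul /GEemb; have [le_li|lt_il] := leqP (norm l) i; last first.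
  rewrite big1 => [|j _]; last first.
    by apply: mul0; left; rewrite ltn_eqF // (leq_trans _ lt_il).
  by rewrite ltn_eqF // (leq_trans lt_il) // leq_addr.
rewrite (bigD1 (Ordinal (le_li : norm l < i.+1)%N)) //= eqxx big1 ?addr0.
  rewrite -[i in RHS](subnKC le_li) eqn_add2l; case: ifP => // _.
  by apply: mul0; right.
move=> j nj; apply: mul0; left; rewrite ifF //; apply: contraNF nj => /eqP e.
by apply/eqP/val_inj.
Qed.

End GroupRing.

Theorem theorem3p5 (F : finFieldType) (n : nat) :
  (* in G_n(q):  K_l(n) K_mu(n) = sum_{||nu|| = ||l||+||mu||} a^nu_{l mu} K_nu(n) *)
  (forall l mu : Raw F, validP l -> validP mu ->
     GEeq (GEmul (GEemb n l) (GEemb n mu))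
          (fun i => \sum_(nu <- cls F n | norm nu == (norm l + norm mu)%N)
                      (GEemb n nu i *~ astab l mu nu))) /\
  (* phi_n : G(q) -> G_n(q), K_l |-> K_l(n), is a surjective algebra hom *)
  (forall x y : GQ F, GQwf x -> GQwf y ->
     GEeq (phi n (GQadd x y)) (GEadd (phi n x) (phi n y))) /\
  (forall x y : GQ F, GQwf x -> GQwf y ->
     GEeq (phi n (GQmul x y)) (GEmul (phi n x) (phi n y))) /\
  GEeq (phi n (GQbasis (emptyRaw F))) (GEone F n) /\
  (forall X : GE F n, GEwf X -> exists x : GQ F, GQwf x /\ GEeq (phi n x) X).
Proof.
split=> [l mu _ _ i|].
  rewrite GEmul_emb; have [iE|ni] := eqVneq i (norm l + norm mu)%N; last first.
    rewrite big1 ?subrr => [|nu /eqP nE].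
      by apply: inKlt_classfun => [|g _ _]; [apply: classfun0|rewrite ffunE].
    by rewrite /GEemb ifF ?mul0rz // nE; apply: contraNF ni.
  rewrite (eq_bigr (fun nu => Kc n nu *~ astab l mu nu)) => [|nu /eqP nE]; last first.
    by rewrite /GEemb nE iE eqxx.
  apply: inKlt_classfun => [|g ug le_g].
    apply: classfunD; first by apply: classfun_mul; apply: classfun_Kc.
    apply/classfunN/classfun_sum => nu _; apply: classfunMz; exact: classfun_Kc.
  (* Norms below [i] are absorbed by the congruence. In norm [i] the coefficient is the stable one,
     and in larger norm both sides vanish. *)
  rewrite ZG_sub sum_Kc ?undup_uniq // mem_cls //=; case: eqP => [nE|nE].
    by rewrite (astabE ug (erefl _)) // subrr.
  rewrite subr0 mulKc_gt // -iE ltn_neqAle le_g andbT.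
  by apply/eqP => e; case: nE; rewrite -e.
split=> [x y _ _|].
  apply: eq_GEeq => i; apply: eq_classfun => [||g ug].
  - exact: classfun_phi.
  - by apply: classfunD; apply: classfun_phi.
  rewrite ffunE !phiE //; case: eqP => // _.
  rewrite /GQadd fsfun_fun in_fsetU; case: ifP => // /negbT.
  by rewrite negb_or => /andP [nx ny]; rewrite !fsfun_dflt.
split=> [x y _ _ i|].
  apply: inKlt_classfun => [|g ug le_g].
    apply: classfunD; first exact: classfun_phi.
    by apply/classfunN/classfun_GEmul => j; apply: classfun_phi.
  rewrite ZG_sub GEmul_phi // phiE //; case: eqP => [nE|/eqP nE].
    apply/eqP; rewrite subr_eq0 GQmulE // nE; apply/eqP.
    apply: eq_bigr => l _; apply: eq_bigr => mu _; rewrite eq_sym.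
    case: eqP => [e|_]; last by rewrite mulr0.
    by rewrite (astabE ug (erefl _)) // nE.
  rewrite sub0r big1 ?oppr0 // => l _; rewrite big1 // => mu _; case: eqP => // e.
  by rewrite mulKc_gt ?mulr0 // e ltn_neqAle le_g eq_sym nE.
split.
  apply: eq_GEeq => i; apply: eq_classfun => [||g ug].
  - exact: classfun_phi.
  - by rewrite /GEone; case: ifP => _; [apply: classfun_oneZG | apply: classfun0].
  rewrite phiE // /GEone /GQbasis fsfun_fun inE modType_eq_empty //.
  have [->|g1] := eqVneq g 1%:M.
    by rewrite norm_modType ?unitmx1 // subrr mxrank0 eq_sym; case: ifP; rewrite !ffunE ?eqxx.
  by rewrite if_same; case: ifP; rewrite !ffunE // (negPf g1).
move=> X [wX _].
(* The coefficient of [K_r] is read from the component of degree [norm r], at an element of modified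
   type [r]. Types outside [cls F n] have zero image and are left out, which keeps the support
   finite. *)
pose x : GQ F := [fsfun r in seq_fset tt (cls F n) =>
  if [pick g : 'M[F]_n | (g \in unitmx) && (modType g == r)] is Some g
  then X (norm r) g else 0].
exists x; split=> [r rx|i].
  have := fsubsetP (finsupp_sub _ _ _) r rx; rewrite seq_fsetE => /clsP [g ug <-].
  exact: validP_modType.
have [cX X0] := inKlt_classfunP (wX i).
apply: inKlt_classfun => [|g ug le_g].
  by apply: classfunD; [apply: classfun_phi | apply: classfunN].
rewrite ZG_sub phiE //; case: eqP => [nE|/eqP nE]; last first.
  by rewrite X0 ?subr0 // ltn_neqAle eq_sym nE.
rewrite /x fsfun_fun seq_fsetE mem_cls // nE.
case: pickP => [h /andP [uh /eqP e]|/(_ g)]; last by rewrite ug eqxx.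
by rewrite (cX.2 h g) // subrr.
Qed.
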